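(* Let $(E,\phi)$ be any $t$-module over $K$ with dual $t$-motive $\check{\mathcal{M}}$, and let $\phi_t-t$ denote the operator $\phi_t\otimes\mathrm{id}-\mathrm{id}\otimes t$ on $\check{\mathcal{M}}\otimes_{\mathbb{C}_\infty}\mathbb{T}$. Then: (1) $\phi_t-t:\check{\mathcal{M}}\otimes_{\mathbb{C}_\infty}\mathbb{T}\to\check{\mathcal{M}}\otimes_{\mathbb{C}_\infty}\mathbb{T}$ is injective; (2) its cokernel is $\check{\mathcal{M}}\otimes_{\mathbb{C}_\infty[t]}\mathbb{T}$; (3) the snake lemma, applied to the vertical maps $\phi_t-t$ between two copies of the exact sequence $0\to\check{\mathcal{M}}\otimes_{\mathbb{C}_\infty}\mathbb{T}\xrightarrow{\sigma\otimes\sigma-\mathrm{id}}\check{\mathcal{M}}\otimes_{\mathbb{C}_\infty}\mathbb{T}\xrightarrow{\mathrm{ev}_1\langle t\rangle}E\langle t\rangle\to0$, yields an isomorphism of $\mathbb{F}_q[t]$-modules \[H\to\bigl(\check{\mathcal{M}}\otimes_{\mathbb{C}_\infty[t]}\mathbb{T}\bigr)^\sigma,\] namely: for $h\in H$ choose $x$ with $\mathrm{ev}_1\langle t\rangle(x)=h$; then $(\phi_t-t)(x)=(\sigma\otimes\sigma-\mathrm{id})(y)$ for a unique $y$, and $h$ is sent to the class of $y$ in $\check{\mathcal{M}}\otimes_{\mathbb{C}_\infty[t]}\mathbb{T}$. Here $(\cdot)^\sigma$ denotes the elements fixed by $\sigma$.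
   Context: $K$ finite extension of $\mathbb{F}_q(\theta)$, $|\theta|=q$, $\mathbb{C}_\infty$ completion of an algebraic closure of $K_\infty$, $\mathbb{T}$ the Tate algebra of power series over $\mathbb{C}_\infty$ converging on $|t|\le1$, with $\sigma(\sum x_it^i)=\sum x_i^{1/q}t^i$. $(E,\phi)$ is a $t$-module over $K$ ($E\cong\mathbb{G}_{a,K}^d$, $\phi:\mathbb{F}_q[t]\to\mathrm{End}_{\mathrm{grp},\mathbb{F}_q}(E)$ an $\mathbb{F}_q$-algebra homomorphism with $d\phi_t-\theta$ nilpotent on $\mathrm{Lie}(E)$). Dual $t$-motive: $\check{\mathcal{M}}=\mathrm{Hom}_{\mathrm{grp},\mathbb{F}_q}(\mathbb{G}_{a,\mathbb{C}_\infty},E_{\mathbb{C}_\infty})$ with $a\cdot m=\phi_a\circ m$ for $a\in\mathbb{F}_q[t]$, $c\cdot m=m\circ c$ for $c\in\mathbb{C}_\infty$, and $\sigma(m)=m\circ\tau$ with $\tau$ the $q$-Frobenius on $\mathbb{G}_a$ (more generally $\psi\cdot m=m\circ\psi^*$ for $\psi=\sum a_i\sigma^i$, $\psi^*=\sum a_i^{q^i}\tau^i$); this makes $\check{\mathcal{M}}$ a $\mathbb{C}_\infty[t]$-module, and $\sigma$ acts diagonally on tensor products with $\mathbb{T}$. $\mathrm{ev}_1(x)=x(1)$, $\mathrm{ev}_1\langle t\rangle(x\otimes\sum_if_it^i)=\sum_i\mathrm{ev}_1(f_ix)t^i$. With coordinates $E(\mathbb{C}_\infty)\cong\mathbb{C}_\infty^d$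 and sup-norm $\|\cdot\|$, $E\langle t\rangle$ is the set of series $\sum_{i\ge0}e_it^i$, $e_i\in E(\mathbb{C}_\infty)$, $\|e_i\|\to0$, and $H=\{h\in E\langle t\rangle\mid\phi_t(h)=h\cdot t\}$ ($\phi_t$ coefficientwise, $h\cdot t$ shift), an $\mathbb{F}_q[t]$-module via $t$-multiplication. *)

(* Defs.v *)
From HB Require Import structures.
From mathcomp Require Import all_boot all_order all_algebra all_solvable all_field.
From mathcomp Require Import boolp classical_sets functions reals.
From mathcomp Require Import freeg mpoly ring.

Set Implicit Arguments.
Unset Strict Implicit.
Unset Printing Implicit Defensive.

Import Order.TTheory GRing.Theory Num.Theory.
Local Open Scope ring_scope.
Local Open Scope quotient_scope.

(* The tensor product over B of two A-modules, restricted along f : B -> A. It *)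
(* is an A-module through its left factor. With f = id this is the tensor      *)
(* product over A.                                                             *)
Section Tensor.
Variables (B A : comNzRingType) (f : {rmorphism B -> A}) (M N : lmodType A).

Local Notation free := {freeg (M * N)%type / int}.
Local Notation gen m n := (Freeg [:: (1 : int, (m, n))] : free).

Inductive tensor_relation : free -> Prop :=
| Tensor_rel0 : tensor_relation 0
| Tensor_relB x y :
    tensor_relation x -> tensor_relation y -> tensor_relation (x - y)
| Tensor_relDl m m' n :
    tensor_relation (gen (m + m') n - (gen m n + gen m' n))
| Tensor_relDr m n n' :
    tensor_relation (gen m (n + n') - (gen m n + gen m n'))
| Tensor_relZ b m n : tensor_relation (gen (f b *: m) n - gen m (f b *: n)).

Definition tensor_rel : {pred free} := fun x => `[< tensor_relation x >].

Lemma tensor_rel_closed : zmod_closed tensor_rel.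
Proof.
split; first exact/asboolP/Tensor_rel0.
by move=> x y /asboolP xP /asboolP yP; apply/asboolP/Tensor_relB.
Qed.

HB.instance Definition _ := GRing.isZmodClosed.Build free tensor_rel
  tensor_rel_closed.

Definition tensor := {ideal_quot tensor_rel}.
HB.instance Definition _ := GRing.Zmodule.on tensor.
HB.instance Definition _ := Quotient.on tensor.

Definition ptensor (m : M) (n : N) : tensor := \pi_tensor (gen m n).


Lemma pi_tensor_is_additive : zmod_morphism (\pi_tensor : free -> tensor).
Proof.
have piN := @Quotient.pi_opp _ tensor_rel.
have piD := @Quotient.pi_add _ tensor_rel.
by move=> x y; rewrite [LHS]piD piN.
Qed.

HB.instance Definition _ := GRing.isZmodMorphism.Build free tensor \pi_tensor
  pi_tensor_is_additive.

Lemma pi_tensor_rel x : tensor_relation x -> \pi_tensor x = 0.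
Proof.
move=> xR; rewrite -(raddf0 \pi_tensor); apply/eqP.
by rewrite -Quotient.idealrBE subr0; apply/asboolP.
Qed.

Lemma ptensorDl m m' n : ptensor (m + m') n = ptensor m n + ptensor m' n.
Proof.
apply/eqP; rewrite -subr_eq0 /ptensor -!raddfD -raddfB; apply/eqP.
exact/pi_tensor_rel/Tensor_relDl.
Qed.

Lemma ptensorDr m n n' : ptensor m (n + n') = ptensor m n + ptensor m n'.
Proof.
apply/eqP; rewrite -subr_eq0 /ptensor -!raddfD -raddfB; apply/eqP.
exact/pi_tensor_rel/Tensor_relDr.
Qed.

Lemma ptensorZ b m n : ptensor (f b *: m) n = ptensor m (f b *: n).
Proof.
apply/eqP; rewrite -subr_eq0 /ptensor -raddfB; apply/eqP.
exact/pi_tensor_rel/Tensor_relZ.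
Qed.

Lemma ptensorNl m n : ptensor (- m) n = - ptensor m n.
Proof.
apply/eqP; rewrite eq_sym -subr_eq0 -opprD oppr_eq0 -ptensorDl subrr.
by have /eqP := ptensorDl 0 0 n; rewrite addr0 -subr_eq subrr eq_sym.
Qed.

Lemma tensor_ind (P : tensor -> Prop) :
  (forall m n, P (ptensor m n)) -> (forall x y, P x -> P y -> P (x + y)) ->
  forall x, P x.
Proof.
move=> Pp PD; have P0 : P 0.
  by rewrite -(subrr (ptensor 0 0)) -ptensorNl; apply: (PD).
elim/quotW => x; rewrite -[x]freeg_sumE raddf_sum.
elim/big_rec: _ => // -[m n] y _; apply: (PD).
rewrite -[Freeg _]/(Freeg [:: (coeff (m, n) x, (m, n))]).
have -> : Freeg [:: (coeff (m, n) x, (m, n))] = gen m n *~ coeff (m, n) x.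
  by rewrite freegU_mulz intz.
rewrite raddfMz; change (P (ptensor m n *~ coeff (m, n) x)).
have PMn k m' : P (ptensor m' n *+ k).
  by elim: k => [|k IHk]; rewrite ?mulr0n // mulrS; apply: (PD).
case: (coeff (m, n) x) => k; first exact: PMn.
by rewrite NegzE mulrNz -mulNrz -ptensorNl; apply: PMn.
Qed.

Record balanced (P : zmodType) (beta : M -> N -> P) : Prop := Balanced {
  balancedDl : forall m m' n, beta (m + m') n = beta m n + beta m' n;
  balancedDr : forall m n n', beta m (n + n') = beta m n + beta m n';
  balancedZ : forall b m n, beta (f b *: m) n = beta m (f b *: n)
}.

Section Lift.
Variables (P : zmodType) (beta : M -> N -> P) (beta_bal : balanced beta).

Definition tensor_lift of balanced beta := fun x : tensor =>
  fglift (fun u => beta u.1 u.2 : zmodule P) (repr x) : P.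
Local Notation lift := (tensor_lift beta_bal).

Lemma tensor_lift_rel x : tensor_relation x ->
  fglift (fun u => beta u.1 u.2 : zmodule P) x = 0.
Proof.
have fD := @lift_is_additive int (M * N)%type (zmodule P)
  (fun u => beta u.1 u.2 : zmodule P).
have fA (y z : free) : fglift (fun u => beta u.1 u.2 : zmodule P) (y + z) =
  fglift (fun u => beta u.1 u.2 : zmodule P) y +
  fglift (fun u => beta u.1 u.2 : zmodule P) z.
  have f0 : fglift (fun u => beta u.1 u.2 : zmodule P) 0 = 0.
    by have := fD 0 0; rewrite !subrr.
  by rewrite -[z in LHS]opprK fD -[- z]sub0r fD f0 sub0r opprK.
elim=> {x} [|x y _ x0 _ y0|m m' n|m n n'|b m n].
- by have := fD 0 0; rewrite !subrr.
- by rewrite fD x0 y0 subr0.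
- by rewrite fD fA !liftU !scale1r /= (balancedDl beta_bal) subrr.
- by rewrite fD fA !liftU !scale1r /= (balancedDr beta_bal) subrr.
- by rewrite fD !liftU !scale1r /= (balancedZ beta_bal) subrr.
Qed.

Lemma tensor_lift_pi x :
  lift (\pi_tensor x) = fglift (fun u => beta u.1 u.2 : zmodule P) x.
Proof.
apply/eqP; rewrite -subr_eq0; apply/eqP.
have fD := @lift_is_additive int (M * N)%type (zmodule P)
  (fun u => beta u.1 u.2 : zmodule P).
have := fD (repr (\pi_tensor x)) x; rewrite /tensor_lift => <-.
apply: tensor_lift_rel; apply/asboolP; rewrite -[asbool _]/(_ \in tensor_rel).
by rewrite Quotient.idealrBE reprK.
Qed.

Lemma tensor_liftE m n : lift (ptensor m n) = beta m n.
Proof. by rewrite tensor_lift_pi liftU scale1r. Qed.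

Lemma tensor_lift_is_additive : zmod_morphism lift.
Proof.
elim/quotW => x; elim/quotW => y.
rewrite -raddfB !tensor_lift_pi.
exact: (@lift_is_additive int (M * N)%type (zmodule P)
  (fun u => beta u.1 u.2 : zmodule P)).
Qed.

HB.instance Definition _ :=
  GRing.isZmodMorphism.Build tensor P lift tensor_lift_is_additive.
End Lift.

Lemma tensor_eq (P : zmodType) (g h : {additive tensor -> P}) :
  (forall m n, g (ptensor m n) = h (ptensor m n)) -> g =1 h.
Proof. by move=> gh; elim/tensor_ind => // x y Hx Hy; rewrite !raddfD Hx Hy. Qed.
End Tensor.

Section TensorModule.
Variables (B A : comNzRingType) (f : {rmorphism B -> A}) (M N : lmodType A).
Local Notation T := (tensor f M N).

Lemma tensor_scale_balanced (a : A) :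
  balanced f (fun m n => ptensor f (a *: m) n : T).
Proof.
split=> [m m' n|m n n'|b m n]; first by rewrite scalerDr ptensorDl.
  by rewrite ptensorDr.
by rewrite scalerA mulrC -scalerA ptensorZ.
Qed.

Definition tensor_scale (a : A) : T -> T :=
  tensor_lift (tensor_scale_balanced a).
HB.instance Definition _ a :=
  GRing.Additive.copy (tensor_scale a) (tensor_lift (tensor_scale_balanced a)).

Lemma tensor_scaleDr : right_distributive tensor_scale +%R.
Proof. by move=> a x y; exact: raddfD. Qed.

Lemma tensor_scaleE a m n :
  tensor_scale a (ptensor f m n) = ptensor f (a *: m) n.
Proof. exact: tensor_liftE. Qed.

Lemma tensor_scaleA a b x :
  tensor_scale a (tensor_scale b x) = tensor_scale (a * b) x.
Proof.
elim/tensor_ind: x => [m n|x y IHx IHy]; last by rewrite !tensor_scaleDr IHx IHy.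
by rewrite !tensor_scaleE scalerA.
Qed.

Lemma tensor_scale1 : left_id 1 tensor_scale.
Proof.
elim/tensor_ind => [m n|x y IHx IHy]; last by rewrite tensor_scaleDr IHx IHy.
by rewrite tensor_scaleE scale1r.
Qed.

Lemma tensor_scaleDl x : {morph tensor_scale^~ x : a b / a + b}.
Proof.
move=> a b; elim/tensor_ind: x => [m n|x y IHx IHy].
  by rewrite !tensor_scaleE scalerDl ptensorDl.
by rewrite !tensor_scaleDr IHx IHy addrACA.
Qed.

HB.instance Definition _ := GRing.Zmodule_isLmodule.Build A T
  tensor_scaleA tensor_scale1 tensor_scaleDr tensor_scaleDl.

Lemma scale_ptensor a m n : a *: ptensor f m n = ptensor f (a *: m) n.
Proof. exact: tensor_scaleE. Qed.
End TensorModule.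

Lemma balanced_map (B A B' A' : comNzRingType) (f : {rmorphism B -> A})
    (f' : {rmorphism B' -> A'}) (M N : lmodType A) (M' N' : lmodType A')
    (u : {additive M -> M'}) (v : {additive N -> N'}) (g : B -> B') :
  (forall b m, u (f b *: m) = f' (g b) *: u m) ->
  (forall b n, v (f b *: n) = f' (g b) *: v n) ->
  balanced f (fun m n => ptensor f' (u m) (v n)).
Proof.
move=> uZ vZ; split=> [m m' n|m n n'|b m n]; first by rewrite raddfD ptensorDl.
  by rewrite raddfD ptensorDr.
by rewrite uZ vZ ptensorZ.
Qed.

Definition restrict_scalars (B A : pzRingType) (f : {rmorphism B -> A})
  (V : lmodType A) : Type := V.

Section Restrict.
Variables (B A : pzRingType) (f : {rmorphism B -> A}) (V : lmodType A).
HB.instance Definition _ := GRing.Zmodule.on (restrict_scalars f V).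

Definition restr_scale (b : B) (v : restrict_scalars f V) : restrict_scalars f V :=
  f b *: (v : V).

Fact restr_scaleA a b v :
  restr_scale a (restr_scale b v) = restr_scale (a * b) v.
Proof. by rewrite /restr_scale scalerA rmorphM. Qed.
Fact restr_scale1 : left_id 1 restr_scale.
Proof. by move=> v; rewrite /restr_scale rmorph1 scale1r. Qed.
Fact restr_scaleDr : right_distributive restr_scale +%R.
Proof. by move=> a v w; rewrite /restr_scale scalerDr. Qed.
Fact restr_scaleDl v : {morph restr_scale^~ v : a b / a + b}.
Proof. by move=> a b; rewrite /restr_scale rmorphD scalerDl. Qed.

HB.instance Definition _ := GRing.Zmodule_isLmodule.Build B (restrict_scalars f V)
  restr_scaleA restr_scale1 restr_scaleDr restr_scaleDl.

Lemma restr_scaleE b (v : restrict_scalars f V) : b *: v = f b *: (v : V).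
Proof. by []. Qed.
End Restrict.

(* The A[t]-module given by an A-module and an endomorphism: t acts as u. *)
Definition polymod (A : comNzRingType) (V : lmodType A) (u : {linear V -> V}) :
  Type := V.

Section PolyModule.
Variables (A : comNzRingType) (V : lmodType A) (u : {linear V -> V}).
HB.instance Definition _ := GRing.Zmodule.on (polymod u).

Definition poly_scale (p : {poly A}) (v : polymod u) : polymod u :=
  \sum_(i < size p) p`_i *: iter i u (v : V).

Lemma iter_is_linear i : linear (iter i u).
Proof. by elim: i => [//|i IHi] a x y; rewrite !iterS IHi linearP. Qed.
HB.instance Definition _ i := GRing.isLinear.Build A V V *:%R (iter i u)
  (iter_is_linear i).

Lemma poly_scale_wide n (p : {poly A}) (v : polymod u) : (size p <= n)%N ->
  poly_scale p v = \sum_(i < n) p`_i *: iter i u (v : V).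
Proof.
move=> le_pn; rewrite /poly_scale (big_ord_widen n (fun i => p`_i *: iter i u v)) //.
rewrite big_mkcond; apply: eq_bigr => i _.
by case: ltnP => // /(nth_default 0) ->; rewrite scale0r.
Qed.

Fact poly_scaleDr : right_distributive poly_scale +%R.
Proof.
move=> p v w; rewrite /poly_scale -big_split; apply: eq_bigr => i _ /=.
by rewrite linearD scalerDr.
Qed.

Fact poly_scaleDl v : {morph poly_scale^~ v : p q / p + q}.
Proof.
move=> p q; pose n := maxn (size (p + q)) (maxn (size p) (size q)).
rewrite !(@poly_scale_wide n) ?leq_max ?leqnn ?orbT // -big_split.
by apply: eq_bigr => i _; rewrite coefD scalerDl.
Qed.

Fact poly_scaleC c v : poly_scale c%:P v = c *: (v : V).
Proof.
by rewrite (@poly_scale_wide 1) ?size_polyC_leq1 // big_ord1 coefC.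
Qed.

Fact poly_scale1 : left_id 1 poly_scale.
Proof. by move=> v; rewrite poly_scaleC scale1r. Qed.

Fact poly_scaleMX p v : poly_scale (p * 'X) v = poly_scale p (u v).
Proof.
rewrite (@poly_scale_wide (size p).+1); last first.
  by rewrite (leq_trans (size_polyMleq _ _)) // size_polyX addn2.
rewrite big_ord_recl coefMX scale0r add0r; apply: eq_bigr => i _.
by rewrite coefMX /= -iterSr.
Qed.

Fact poly_scale_u p v : poly_scale p (u v) = u (poly_scale p v).
Proof.
rewrite /poly_scale linear_sum; apply: eq_bigr => i _.
by rewrite linearZ -iterSr.
Qed.

Fact poly_scaleZ c p v : poly_scale (c *: p) v = c *: (poly_scale p v : V).
Proof.
rewrite (@poly_scale_wide (size p)) ?size_scale_leq // scaler_sumr.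
by apply: eq_bigr => i _; rewrite coefZ scalerA.
Qed.

Fact poly_scaleA p q v :
  poly_scale p (poly_scale q v) = poly_scale (p * q) v.
Proof.
elim/poly_ind: p => [|p c IHp] in v *.
  by rewrite mul0r /poly_scale size_poly0 !big_ord0.
rewrite mulrDl !poly_scaleDl poly_scaleMX -poly_scale_u IHp.
rewrite -[p * 'X * q]mulrA (mulrC 'X) mulrA poly_scaleMX; congr (_ + _).
by rewrite poly_scaleC mul_polyC poly_scaleZ.
Qed.

HB.instance Definition _ := GRing.Zmodule_isLmodule.Build {poly A} (polymod u)
  poly_scaleA poly_scale1 poly_scaleDr poly_scaleDl.

Lemma polymodC c (v : polymod u) : c%:P *: v = c *: (v : V) :> V.
Proof. exact: poly_scaleC. Qed.

Lemma polymodX (v : polymod u) : 'X *: v = u v :> V.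
Proof. by rewrite -['X]mul1r [LHS]poly_scaleMX poly_scale1. Qed.
End PolyModule.

Lemma polymod_semilinear (A A' : comNzRingType) (g : {rmorphism A -> A'})
    (V : lmodType A) (V' : lmodType A') (u : {linear V -> V})
    (u' : {linear V' -> V'}) (s : {additive V -> V'}) :
  (forall a v, s (a *: v) = g a *: s v) -> (forall v, s (u v) = u' (s v)) ->
  forall p (v : polymod u), s (p *: v) = map_poly g p *: (s v : polymod u').
Proof.
move=> sZ su p v; rewrite [RHS](@poly_scale_wide _ _ _ (size p)) ?size_poly //.
rewrite raddf_sum; apply: eq_bigr => i _; rewrite sZ coef_map; congr (_ *: _).
by elim: (val i) => //= j <-.
Qed.

Definition shift (V : zmodType) (v : nat -> V) : nat -> V :=
  fun n => if n is n'.+1 then v n' else 0.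

Section Series.
Variables (A : comNzRingType) (V : lmodType A).

Fact shift_is_linear : linear (@shift V : (nat -> V) -> (nat -> V)).
Proof.
move=> a v w; apply/funext => -[|n] //.
by change (0 = a *: (0 : V) + 0); rewrite scaler0 addr0.
Qed.
HB.instance Definition _ := GRing.isLinear.Build A (nat -> V) (nat -> V) *:%R
  (@shift V) shift_is_linear.

(* V[[t]] as an A[t]-module: t acts by the shift. *)
Definition series : Type := polymod (@shift V).
HB.instance Definition _ := GRing.Lmodule.on series.

Lemma seriesX (v : series) : 'X *: v = shift v :> (nat -> V).
Proof. exact: polymodX. Qed.
End Series.

Lemma q_gt0 (Fq : finFieldType) : (0 < #|Fq|)%N.
Proof. by apply/card_gt0P; exists 0. Qed.

Lemma pchar_q (Fq : finFieldType) (S : nzRingType) (h : {rmorphism Fq -> S}) :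
  [pchar S].-nat #|Fq|.
Proof.
have [p _ pF] := finPcharP Fq.
rewrite (eq_pnat _ (pcharf_eq (rmorph_pchar h pF))) -cardsT.
exact: abelem_pgroup (fin_ring_pchar_abelem pF).
Qed.

Section BaseField.
Variables (Fq : finFieldType) (K : fieldExtType {fraction {poly Fq}}).

Definition theta : K := (tofrac ('X : {poly Fq}))%:A.
Definition constK : {rmorphism Fq -> K} :=
  in_alg K \o (@tofrac {poly Fq}) \o polyC.
End BaseField.

Section AbsoluteValue.
Variables (R : realType) (C : fieldType) (abs : C -> R).

Record nonarch_absolute_value : Prop := NonarchAbsoluteValue {
  abs_ge0 : forall x, 0 <= abs x;
  abs_eq0 : forall x, abs x = 0 <-> x = 0;
  absM : forall x y, abs (x * y) = abs x * abs y;
  abs_ultra : forall x y, abs (x + y) <= Num.max (abs x) (abs y)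
}.

Definition abs_cvg (u : nat -> C) (l : C) : Prop :=
  forall e : R, 0 < e -> exists N, forall n, (N <= n)%N -> abs (u n - l) < e.

Definition abs_cauchy (u : nat -> C) : Prop :=
  forall e : R, 0 < e -> exists N, forall m n, (N <= m)%N -> (N <= n)%N ->
    abs (u m - u n) < e.

Definition abs_complete : Prop :=
  forall u, abs_cauchy u -> exists l, abs_cvg u l.

Definition abs_adherent (P : C -> Prop) (x : C) : Prop :=
  forall e : R, 0 < e -> exists2 y, P y & abs (x - y) < e.
End AbsoluteValue.

Definition algebraic_over (C : fieldType) (P : C -> Prop) (x : C) : Prop :=
  exists p : {poly C}, [/\ p != 0, forall i, P p`_i & root p x].

Definition alg_closed (C : fieldType) (P : C -> Prop) : Prop :=
  forall p : {poly C}, (1 < size p)%N -> (forall i, P p`_i) ->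
    exists2 x, P x & root p x.

(* The closure of K in the complete field C is a completion K_infty of K for   *)
(* the absolute value induced by C. On F_q(theta) this is the usual absolute   *)
(* value at infinity: it is nonarchimedean, trivial on the finite field F_q,   *)
(* and |theta| = q > 1.                                                        *)
Record Cinfty (R : realType) (Fq : finFieldType)
    (K : fieldExtType {fraction {poly Fq}}) := MkCinfty {
  Cfield :> fieldType;
  Cabs : Cfield -> R;
  Kin : {rmorphism K -> Cfield};
  Kinfty : Cfield -> Prop := abs_adherent Cabs (fun x => exists a, x = Kin a);
  Kbar : Cfield -> Prop := algebraic_over Kinfty;
  CabsP : nonarch_absolute_value Cabs;
  Cabs_theta : Cabs (Kin (theta K)) = #|Fq|%:R;
  Ccomplete : abs_complete Cabs;
  Kbar_closed : alg_closed Kbar;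
  Kbar_dense : forall x, abs_adherent Cabs Kbar x
}.

Arguments Cabs {R Fq K} C _ : rename.
Arguments Kin {R Fq K} C : rename.
Arguments Kinfty {R Fq K} C _ : rename.
Arguments Kbar {R Fq K} C _ : rename.

Section CinftyTheory.
Variables (R : realType) (Fq : finFieldType)
  (K : fieldExtType {fraction {poly Fq}}) (C : Cinfty R K).
Local Notation abs := (Cabs C).
Local Notation q := #|Fq|.

Definition constC : {rmorphism Fq -> C} := Kin C \o constK K.

Lemma cabs0 : abs 0 = 0. Proof. exact/(abs_eq0 (CabsP C)). Qed.
Lemma cabs1 : abs 1 = 1.
Proof.
have n0 : abs 1 != 0.
  by apply/eqP => /(abs_eq0 (CabsP C))/eqP; rewrite oner_eq0.
by apply: (mulIf n0); rewrite mul1r -(absM (CabsP C)) mul1r.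
Qed.
Lemma cabsX x n : abs (x ^+ n) = abs x ^+ n.
Proof.
by elim: n => [|n IHn]; rewrite ?cabs1 // !exprS (absM (CabsP C)) IHn.
Qed.
Lemma cabsN x : abs (- x) = abs x.
Proof.
suff a1 : abs (-1) = 1 by rewrite -mulN1r (absM (CabsP C)) a1 mul1r.
apply/eqP; rewrite -(@eqrXn2 R 2) ?ler01 ?(abs_ge0 (CabsP C)) //.
by rewrite -cabsX sqrrN !expr1n cabs1.
Qed.
Lemma cabsD_lt x y e : abs x < e -> abs y < e -> abs (x + y) < e.
Proof.
by move=> xe ye; apply: le_lt_trans (abs_ultra (CabsP C) x y) _; rewrite gt_max xe.
Qed.
Lemma cabsD_le x y e : abs x <= e -> abs y <= e -> abs (x + y) <= e.
Proof.
by move=> xe ye; apply: le_trans (abs_ultra (CabsP C) x y) _; rewrite ge_max xe.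
Qed.

Lemma expqD (x y : C) : (x + y) ^+ q = x ^+ q + y ^+ q.
Proof. exact/exprDn_pchar/(pchar_q constC). Qed.
Lemma expqN (x : C) : (- x) ^+ q = - x ^+ q.
Proof. exact/exprNn_pchar/(pchar_q constC). Qed.
Lemma expqI : injective (fun x : C => x ^+ q).
Proof.
move=> x y /eqP; rewrite -subr_eq0 -expqN -expqD expf_eq0 (q_gt0 Fq) subr_eq0.
by move/eqP.
Qed.
Lemma expq_const c : constC c ^+ q = constC c.
Proof. by rewrite -rmorphXn expf_card. Qed.

Lemma Kinfty_Kin a : Kinfty C (Kin C a).
Proof. by move=> e e0; exists (Kin C a); rewrite ?subrr ?cabs0 //; exists a. Qed.

Lemma Kbar_Kin a : Kbar C (Kin C a).
Proof.
exists ('X - (Kin C a)%:P); split; rewrite ?polyXsubC_eq0 ?root_XsubC //.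
move=> i; rewrite coefB coefX coefC -(rmorph0 (Kin C)).
have -> : (i == 1%N)%:R = Kin C (i == 1%N)%:R :> C by rewrite rmorph_nat.
by rewrite -fun_if -rmorphB; exact: Kinfty_Kin.
Qed.

Lemma qroot_exists (x : C) : exists y : C, y ^+ q = x.
Proof.
have ex n : exists y : C, abs (- x + y ^+ q) < n.+1%:R^-1 ^+ q.
  have e0 : 0 < n.+1%:R^-1 ^+ q :> R by rewrite exprn_gt0 // invr_gt0 ltr0Sn.
  have [z zK zx] := Kbar_dense (- x) e0.
  have [||y _ /rootP] := @Kbar_closed _ _ _ C ('X^q + z%:P).
  - by rewrite size_XnaddC ?(q_gt0 Fq) // ltnS (q_gt0 Fq).
  - move=> i; rewrite coefD coefXn coefC.
    have [->|_] := eqVneq i q.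
      by rewrite -[q == 0]/(q == 0%N) gtn_eqF ?(q_gt0 Fq) // addr0; rewrite -(rmorph1 (Kin C)); exact: Kbar_Kin.
    by rewrite add0r; case: eqP => // _; try rewrite -(rmorph0 (Kin C)); exact: Kbar_Kin.
  rewrite hornerD hornerXn hornerC => /eqP; rewrite addr_eq0 => /eqP yz.
  by exists y; rewrite yz.
have [y yP] := choice ex.
have small (e : R) : 0 < e -> exists N, forall n, (N <= n)%N -> n.+1%:R^-1 < e.
  move=> e0; have [N Ne] : exists N : nat, e^-1 < N%:R.
    by exists (Num.truncn e^-1).+1; rewrite truncnS_gt.
  exists N => n Nn; rewrite -[e]invrK ltf_pV2 ?posrE ?invr_gt0 ?ltr0Sn //.
  by rewrite (lt_le_trans Ne) // ler_nat leqW.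
have yC : abs_cauchy abs y.
  move=> e /small[N NP]; exists N => m n Nm Nn.
  have e0 : 0 < e by apply: lt_trans (NP _ (leqnn N)); rewrite invr_gt0 ltr0Sn.
  rewrite -(ltr_pXn2r (q_gt0 Fq)) ?nnegrE ?(abs_ge0 (CabsP C)) ?ltW //.
  rewrite -cabsX expqD expqN.
  have -> : y m ^+ q - y n ^+ q = (- x + y m ^+ q) + - (- x + y n ^+ q).
    by rewrite opprD opprK addrACA addNr add0r.
  have bd k : (N <= k)%N -> abs (- x + y k ^+ q) < e ^+ q.
    move=> Nk; apply: lt_trans (yP k) _.
    by rewrite (ltr_pXn2r (q_gt0 Fq)) ?nnegrE ?invr_ge0 ?ler0n ?NP // ltW.
  by apply: cabsD_lt; rewrite ?cabsN bd.
have [l lP] := Ccomplete yC; exists l.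
apply: contrapT => lx; set d := abs (l ^+ q - x).
have d0 : 0 < d.
  rewrite lt_def (abs_ge0 (CabsP C)) andbT; apply/eqP => /(abs_eq0 (CabsP C)).
  by move/eqP; rewrite subr_eq0 => /eqP.
pose e : R := Num.min 1 d.
have e0 : 0 < e by rewrite lt_min ltr01.
have ed : e ^+ q <= d.
  have e1 : e <= 1 by rewrite ge_min lexx.
  rewrite (@le_trans _ _ e) //; last by rewrite ge_min lexx orbT.
  by rewrite -[leRHS]expr1 ler_wiXn2l ?(ltW e0) ?(q_gt0 Fq).
have [N1 N1P] := lP e e0; have [N2 N2P] := small e e0; pose n := maxn N1 N2.
suff : d < d by rewrite ltxx.
rewrite {1}/d; have -> : l ^+ q - x = - (y n - l) ^+ q + (- x + y n ^+ q).
  by rewrite expqD expqN opprD opprK [- x + _]addrC addrACA addNr add0r.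
have pw (a b : R) : 0 <= a -> 0 <= b -> a < b -> a ^+ q < b ^+ q.
  by move=> a_ge0 b_ge0 ab; rewrite (ltr_pXn2r (q_gt0 Fq)) ?nnegrE.
apply: cabsD_lt; apply: lt_le_trans ed; last first.
  by rewrite (lt_trans (yP n)) // pw ?invr_ge0 ?ler0n ?ltW ?N2P ?leq_maxr.
by rewrite cabsN cabsX pw ?(abs_ge0 (CabsP C)) ?ltW // N1P ?leq_maxl.
Qed.

Definition qroot (x : C) : C := sval (cid (qroot_exists x)).

Lemma qrootK x : qroot x ^+ q = x. Proof. exact: (svalP (cid (qroot_exists x))). Qed.
Lemma expqK x : qroot (x ^+ q) = x. Proof. exact/expqI/qrootK. Qed.

Fact qroot_is_additive : zmod_morphism qroot.
Proof. by move=> x y; apply: expqI; rewrite expqD expqN !qrootK. Qed.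
Fact qroot_is_multiplicative : monoid_morphism qroot.
Proof.
by split=> [|x y]; apply: expqI; rewrite ?exprMn !qrootK ?expr1n.
Qed.
HB.instance Definition _ := GRing.isZmodMorphism.Build C C qroot
  qroot_is_additive.
HB.instance Definition _ := GRing.isMonoidMorphism.Build C C qroot
  qroot_is_multiplicative.

Lemma qroot_const c : qroot (constC c) = constC c.
Proof. by apply: expqI; rewrite qrootK expq_const. Qed.

End CinftyTheory.

(* The map G_a^n(S) -> G_a^m(S) on the points with values in a k-algebra S,    *)
(* given by h : k -> S, of the morphism of schemes with coordinates f.         *)
HB.lock Definition eval_pts (k : fieldType) (n m : nat) (S : comNzRingType)
    (h : {rmorphism k -> S}) (f : {ffun 'I_m -> {mpoly k[n]}})
    (x : {ffun 'I_n -> S}) : {ffun 'I_m -> S} := [ffun j => mmap h x (f j)].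

Lemma eval_ptsE (k : fieldType) (n m : nat) (S : comNzRingType)
    (h : {rmorphism k -> S}) (f : {ffun 'I_m -> {mpoly k[n]}})
    (x : {ffun 'I_n -> S}) j : eval_pts h f x j = mmap h x (f j).
Proof. by rewrite eval_pts.unlock ffunE. Qed.

Section VectorGroups.
Variables (Fq : finFieldType) (k : fieldType) (eta : {rmorphism Fq -> k}).

Definition scale_pts n (S : comNzRingType) (c : S) (x : {ffun 'I_n -> S}) :
  {ffun 'I_n -> S} := [ffun i => c * x i].

(* By Yoneda, a morphism of schemes respects the group laws and the F_q-action *)
(* iff it does so on points with values in any k-algebra.                      *)
Definition is_vhom n m (f : {ffun 'I_m -> {mpoly k[n]}}) : Prop :=
  forall (S : comNzRingType) (h : {rmorphism k -> S}),
    (forall x y, eval_pts h f (x + y) = eval_pts h f x + eval_pts h f y) /\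
    (forall c x, eval_pts h f (scale_pts (h (eta c)) x) =
                 scale_pts (h (eta c)) (eval_pts h f x)).

Definition vhom_pred n m : {pred {ffun 'I_m -> {mpoly k[n]}}} :=
  fun f => `[< is_vhom f >].

Lemma eval_ptsB n m (S : comNzRingType) (h : {rmorphism k -> S})
    (f g : {ffun 'I_m -> {mpoly k[n]}}) x :
  eval_pts h (f - g) x = eval_pts h f x - eval_pts h g x.
Proof. by apply/ffunP => j; rewrite !(eval_ptsE, ffunE) raddfB. Qed.

Lemma scale_ptsB n (S : comNzRingType) (c : S) (x y : {ffun 'I_n -> S}) :
  scale_pts c (x - y) = scale_pts c x - scale_pts c y.
Proof. by apply/ffunP => j; rewrite !(eval_ptsE, ffunE) mulrBr. Qed.

Lemma eval_pts0 n m (S : comNzRingType) (h : {rmorphism k -> S}) x :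
  eval_pts h (0 : {ffun 'I_m -> {mpoly k[n]}}) x = 0.
Proof. by apply/ffunP => j; rewrite !(eval_ptsE, ffunE) raddf0. Qed.

Lemma vhom_closed n m : zmod_closed (@vhom_pred n m).
Proof.
split=> [|f g /asboolP fP /asboolP gP]; apply/asboolP => S h.
  split=> [x y|c x]; rewrite !eval_pts0 ?addr0 //.
  by apply/ffunP => j; rewrite !(eval_ptsE, ffunE) mulr0.
have [fD fZ] := fP S h; have [gD gZ] := gP S h; split=> [x y|c x].
  by rewrite !eval_ptsB fD gD opprD addrACA.
by rewrite !eval_ptsB fZ gZ scale_ptsB.
Qed.
HB.instance Definition _ n m := GRing.isZmodClosed.Build
  {ffun 'I_m -> {mpoly k[n]}} (@vhom_pred n m) (@vhom_closed n m).

Record vhom n m := VHom {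
  vhom_val :> {ffun 'I_m -> {mpoly k[n]}};
  _ : vhom_val \in @vhom_pred n m
}.
HB.instance Definition _ n m := [isSub for @vhom_val n m].
HB.instance Definition _ n m := [Choice of vhom n m by <:].
HB.instance Definition _ n m := [SubChoice_isSubZmodule of vhom n m by <:].

Definition mk_vhom n m f (fP : is_vhom f) : vhom n m := VHom (introT (asboolP _) fP).

Lemma vhomP n m (f : vhom n m) : is_vhom f.
Proof. by apply/asboolP; exact: (valP f). Qed.

Section Points.
Variables (S : comNzRingType) (h : {rmorphism k -> S}) (n m : nat).
Implicit Types (f g : vhom n m) (x y : {ffun 'I_n -> S}).

Lemma vhomD f x y : eval_pts h f (x + y) = eval_pts h f x + eval_pts h f y.
Proof. exact: (vhomP f h).1. Qed.

Lemma vhomZ f c x : eval_pts h f (scale_pts (h (eta c)) x) =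
  scale_pts (h (eta c)) (eval_pts h f x).
Proof. exact: (vhomP f h).2. Qed.

Lemma vhom0 f : eval_pts h f 0 = 0.
Proof. by apply: (addrI (eval_pts h f 0)); rewrite -vhomD !addr0. Qed.

Lemma eval_vhomD f g x :
  eval_pts h (f + g) x = eval_pts h f x + eval_pts h g x.
Proof. by apply/ffunP => j; rewrite !(eval_ptsE, ffunE) raddfD. Qed.
End Points.

Lemma eval_pts_natural n m (S S' : comNzRingType) (h : {rmorphism k -> S})
    (r : {rmorphism S -> S'}) (f : {ffun 'I_m -> {mpoly k[n]}}) x :
  [ffun j => r (eval_pts h f x j)] = eval_pts (r \o h) f [ffun i => r (x i)].
Proof.
apply/ffunP => j; rewrite !(eval_ptsE, ffunE) /mmap rmorph_sum; apply: eq_bigr => M _.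
rewrite rmorphM /mmap1 rmorph_prod; congr (_ * _); apply: eq_bigr => i _.
by rewrite rmorphXn ffunE.
Qed.

Lemma eq_eval_pts n m (S : comNzRingType) (h h' : {rmorphism k -> S})
    (f : {ffun 'I_m -> {mpoly k[n]}}) x :
  h =1 h' -> eval_pts h f x = eval_pts h' f x.
Proof.
move=> hh'; apply/ffunP => j; rewrite !(eval_ptsE, ffunE) /mmap.
by apply: eq_bigr => M _; rewrite hh'.
Qed.

Definition generic_pt n : {ffun 'I_n -> {mpoly k[n]}} := [ffun i => 'X_i].

Lemma eval_generic n m (f : {ffun 'I_m -> {mpoly k[n]}}) :
  eval_pts (@mpolyC n k) f (generic_pt n) = f.
Proof.
apply/ffunP => j; rewrite eval_ptsE -[RHS](comp_mpoly_id (f j)) /comp_mpoly /mmap.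
apply: eq_bigr => M _; congr (_ * _); apply: eq_bigr => i _.
by rewrite tnth_mktuple ffunE.
Qed.

(* The composite g o f is the value of g at f, viewed as a point of G_a^m with *)
(* values in the ring of functions of G_a^n.                                   *)
Definition comp_pts n m l (g : {ffun 'I_l -> {mpoly k[m]}})
    (f : {ffun 'I_m -> {mpoly k[n]}}) : {ffun 'I_l -> {mpoly k[n]}} :=
  eval_pts (@mpolyC n k) g f.

Lemma eval_comp_pts n m l (g : {ffun 'I_l -> {mpoly k[m]}})
    (f : {ffun 'I_m -> {mpoly k[n]}}) (S : comNzRingType)
    (h : {rmorphism k -> S}) x :
  eval_pts h (comp_pts g f) x = eval_pts h g (eval_pts h f x).
Proof.
transitivity [ffun j => mmap h x (comp_pts g f j)].
  by apply/ffunP => j; rewrite eval_ptsE ffunE.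
rewrite (eval_pts_natural (@mpolyC n k) (mmap h x)).
have -> : [ffun i => mmap h x (f i)] = eval_pts h f x.
  by apply/ffunP => i; rewrite !(eval_ptsE, ffunE).
by apply: eq_eval_pts => c /=; rewrite mmapC.
Qed.

Lemma comp_is_vhom n m l (g : vhom m l) (f : vhom n m) :
  is_vhom (comp_pts g f).
Proof.
move=> S h; split=> [x y|c x]; rewrite !eval_comp_pts.
  by rewrite !vhomD.
by rewrite !vhomZ.
Qed.
Definition vcomp n m l (g : vhom m l) (f : vhom n m) : vhom n l :=
  mk_vhom (comp_is_vhom g f).

Lemma scalar_is_vhom n (c : k) :
  is_vhom [ffun i => c *: 'X_i : {mpoly k[n]}].
Proof.
have E (S : comNzRingType) (h : {rmorphism k -> S}) x :
    eval_pts h [ffun i => c *: 'X_i : {mpoly k[n]}] x = scale_pts (h c) x.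
  by apply/ffunP => j; rewrite !(eval_ptsE, ffunE) mmapZ mmapX mmap1U.
move=> S h; split=> [x y|b x]; rewrite !E.
  by apply/ffunP => j; rewrite !(eval_ptsE, ffunE) mulrDr.
by apply/ffunP => j; rewrite !(eval_ptsE, ffunE) mulrCA.
Qed.
Definition vscalar n (c : k) : vhom n n := mk_vhom (@scalar_is_vhom n c).

Lemma eval_vscalar n c (S : comNzRingType) (h : {rmorphism k -> S}) x :
  eval_pts h (vscalar n c) x = scale_pts (h c) x.
Proof. by apply/ffunP => j; rewrite !(eval_ptsE, ffunE) mmapZ mmapX mmap1U. Qed.

Lemma frobenius_is_vhom n : is_vhom [ffun i => 'X_i ^+ #|Fq| : {mpoly k[n]}].
Proof.
have E (S : comNzRingType) (h : {rmorphism k -> S}) x j :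
    eval_pts h [ffun i => 'X_i ^+ #|Fq| : {mpoly k[n]}] x j = x j ^+ #|Fq|.
  by rewrite !(eval_ptsE, ffunE) rmorphXn /= mmapX mmap1U.
move=> S h; split=> [x y|b x]; apply/ffunP => j; rewrite !(E, ffunE).
  exact/exprDn_pchar/(pchar_q (h \o eta)).
by rewrite exprMn -!rmorphXn expf_card.
Qed.
Definition vfrobenius n : vhom n n := mk_vhom (@frobenius_is_vhom n).

Lemma eval_vfrobenius n (S : comNzRingType) (h : {rmorphism k -> S}) x j :
  eval_pts h (vfrobenius n) x j = x j ^+ #|Fq|.
Proof. by rewrite !(eval_ptsE, ffunE) rmorphXn /= mmapX mmap1U. Qed.

Lemma vhom_eq n m (f g : vhom n m) :
  (forall (S : comNzRingType) (h : {rmorphism k -> S}) x,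
     eval_pts h f x = eval_pts h g x) -> f = g.
Proof.
move=> fg; apply: val_inj; have := fg _ (@mpolyC n k) (generic_pt n).
by rewrite !eval_generic.
Qed.

(* Differential at the origin. *)
Definition jacobian0 n m (f : {ffun 'I_m -> {mpoly k[n]}}) : 'M[k]_(m, n) :=
  \matrix_(i, j) ((f i)^`M(j)).@[fun => 0].
End VectorGroups.

(* In coordinates E = G_a^d. The last but one field, together with the first   *)
(* two, makes tm_phi a homomorphism of F_q-algebras (c = 1 gives the unit).    *)
Record tmodule (Fq : finFieldType) (K : fieldExtType {fraction {poly Fq}})
    (d : nat) := TModule {
  tm_phi :> {poly Fq} -> vhom (constK K) d d;
  tm_phiD : forall a b, tm_phi (a + b) = tm_phi a + tm_phi b;
  tm_phiM : forall a b, tm_phi (a * b) = vcomp (tm_phi a) (tm_phi b);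
  tm_phiC : forall c, tm_phi c%:P = vscalar (constK K) d (constK K c);
  tm_nilpotent : exists n,
    (jacobian0 (tm_phi 'X) - (theta K)%:M : 'M[K]_d) ^+ n = 0
}.

Section DualMotive.
Variables (R : realType) (Fq : finFieldType)
  (K : fieldExtType {fraction {poly Fq}}) (C : Cinfty R K) (d : nat).

(* Hom(G_a, E) over C, as a C-vector space: c acts by precomposition. *)
Definition ga_hom : Type := vhom (constC C) 1 d.
HB.instance Definition _ := GRing.Zmodule.on ga_hom.

Definition ga_hom_scale (c : C) (m : ga_hom) : ga_hom :=
  vcomp m (vscalar (constC C) 1 c).

Lemma eval_ga_hom_scale c m (S : comNzRingType) (h : {rmorphism C -> S}) x :
  eval_pts h (ga_hom_scale c m : vhom _ _ _) x =
  eval_pts h (m : vhom _ _ _) (scale_pts (h c) x).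
Proof. by rewrite eval_comp_pts eval_vscalar. Qed.

Fact ga_hom_scaleA a b m :
  ga_hom_scale a (ga_hom_scale b m) = ga_hom_scale (a * b) m.
Proof.
apply: vhom_eq => S h x; rewrite !eval_ga_hom_scale; congr (eval_pts _ _ _).
by apply/ffunP => j; rewrite !ffunE rmorphM mulrA (mulrC (h b)).
Qed.
Fact ga_hom_scale1 : left_id 1 ga_hom_scale.
Proof.
move=> m; apply: vhom_eq => S h x; rewrite eval_ga_hom_scale.
by congr (eval_pts _ _ _); apply/ffunP => j; rewrite !ffunE rmorph1 mul1r.
Qed.
Fact ga_hom_scaleDr : right_distributive ga_hom_scale +%R.
Proof.
by move=> a m n; apply: vhom_eq => S h x; rewrite eval_vhomD !eval_ga_hom_scale eval_vhomD.
Qed.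
Fact ga_hom_scaleDl m : {morph ga_hom_scale^~ m : a b / a + b}.
Proof.
move=> a b; apply: vhom_eq => S h x; rewrite eval_vhomD !eval_ga_hom_scale -vhomD.
by congr (eval_pts _ _ _); apply/ffunP => j; rewrite !ffunE rmorphD mulrDl.
Qed.
HB.instance Definition _ := GRing.Zmodule_isLmodule.Build C ga_hom
  ga_hom_scaleA ga_hom_scale1 ga_hom_scaleDr ga_hom_scaleDl.

Variable phi : tmodule K d.

(* phi_a is defined over K, whence the base change along K -> C. *)
Definition tm_act_pts (a : {poly Fq}) (m : ga_hom) :
    {ffun 'I_d -> {mpoly C[1]}} :=
  eval_pts (@mpolyC 1 C \o Kin C) (phi a) (m : vhom _ _ _).

Lemma eval_tm_act_pts a m (S : comNzRingType) (h : {rmorphism C -> S}) x :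
  eval_pts h (tm_act_pts a m) x =
  eval_pts (h \o Kin C) (phi a) (eval_pts h (m : vhom _ _ _) x).
Proof.
transitivity [ffun j => mmap h x (tm_act_pts a m j)].
  by apply/ffunP => j; rewrite eval_ptsE ffunE.
rewrite (eval_pts_natural _ (mmap h x)).
have -> : [ffun i => mmap h x ((m : vhom _ _ _) i)] =
    eval_pts h (m : vhom _ _ _) x.
  by apply/ffunP => i; rewrite !(eval_ptsE, ffunE).
by apply: eq_eval_pts => c /=; rewrite mmapC.
Qed.

Fact tm_act_is_vhom a m : is_vhom (constC C) (tm_act_pts a m).
Proof.
move=> S h; split=> [x y|c x]; rewrite !eval_tm_act_pts.
  by rewrite !vhomD.
rewrite vhomZ.
exact: (vhomZ (h \o Kin C) (phi a) c).
Qed.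
Definition tm_act (a : {poly Fq}) (m : ga_hom) : ga_hom :=
  mk_vhom (@tm_act_is_vhom a m).

Fact tm_act_is_linear a : linear (tm_act a).
Proof.
move=> c m n; apply: vhom_eq => S h x.
rewrite [LHS]eval_tm_act_pts [in LHS]eval_vhomD [in LHS]eval_ga_hom_scale vhomD.
by rewrite eval_vhomD eval_ga_hom_scale !eval_tm_act_pts.
Qed.
HB.instance Definition _ a := GRing.isLinear.Build C ga_hom ga_hom *:%R
  (tm_act a) (tm_act_is_linear a).

(* The dual t-motive Hom(G_a, E), as a module over C[t]. *)
Definition dmotive : Type := polymod (tm_act 'X).
HB.instance Definition _ := GRing.Lmodule.on dmotive.

Lemma tm_act_phiM a b m : tm_act (a * b) m = tm_act a (tm_act b m).
Proof.
apply: vhom_eq => S h x; rewrite 2!eval_tm_act_pts tm_phiM.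
by rewrite eval_comp_pts -eval_tm_act_pts -eval_tm_act_pts.
Qed.

Lemma tm_act_phiD a b m : tm_act (a + b) m = tm_act a m + tm_act b m.
Proof.
apply: vhom_eq => S h x; rewrite eval_vhomD !eval_tm_act_pts tm_phiD.
exact: eval_vhomD.
Qed.

Lemma tm_act_phiC c m : tm_act c%:P m = constC C c *: m.
Proof.
apply: vhom_eq => S h x; rewrite eval_ga_hom_scale eval_tm_act_pts tm_phiC.
by rewrite eval_vscalar vhomZ.
Qed.

Lemma dmotive_scale_const (a : {poly Fq}) (m : dmotive) :
  map_poly (constC C) a *: m = tm_act a m :> ga_hom.
Proof.
elim/poly_ind: a => [|a c IHa] in m *.
  rewrite rmorph0 scale0r; apply/esym.
  by apply: (addrI (tm_act 0 m)); rewrite -tm_act_phiD !addr0.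
rewrite rmorphD rmorphM /= map_polyX map_polyC scalerDl.
rewrite [LHS]/(_ + _) -scalerA IHa.
rewrite tm_act_phiD tm_act_phiM tm_act_phiC; congr (_ + _).
  by congr (tm_act a _); exact: polymodX.
exact: polymodC.
Qed.

Definition msigma (m : dmotive) : dmotive :=
  vcomp (m : vhom _ _ _) (vfrobenius (constC C) 1).

Lemma eval_msigma m (S : comNzRingType) (h : {rmorphism C -> S}) x :
  eval_pts h (msigma m : vhom _ _ _) x =
  eval_pts h (m : vhom _ _ _) [ffun j => x j ^+ #|Fq|].
Proof.
rewrite eval_comp_pts; congr (eval_pts _ _ _).
by apply/ffunP => j; rewrite ffunE eval_vfrobenius.
Qed.

Fact msigma_is_additive : zmod_morphism msigma.
Proof.
suff sD : {morph msigma : m n / m + n}.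
  have s0 : msigma 0 = 0 by apply: (addrI (msigma 0)); rewrite -sD !addr0.
  have sN m : msigma (- m) = - msigma m.
    by apply: (addrI (msigma m)); rewrite -sD !subrr s0.
  by move=> m n; rewrite sD sN.
move=> m n; apply: vhom_eq => S h x.
by rewrite eval_vhomD !eval_msigma eval_vhomD.
Qed.
HB.instance Definition _ := GRing.isZmodMorphism.Build dmotive dmotive msigma
  msigma_is_additive.

Lemma msigma_scale (p : {poly C}) (m : dmotive) :
  msigma (p *: m) = map_poly (@qroot R Fq K C) p *: msigma m.
Proof.
apply: (polymod_semilinear (g := @qroot R Fq K C) (s := msigma)).
  move=> c n; apply: vhom_eq => S h x.
  rewrite eval_msigma !eval_ga_hom_scale [RHS]eval_msigma.
  congr (eval_pts _ _ _); apply/ffunP => j; rewrite !ffunE exprMn.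
  by rewrite -rmorphXn qrootK.
move=> n; apply: vhom_eq => S h x.
by rewrite eval_msigma !eval_tm_act_pts eval_msigma.
Qed.

End DualMotive.

Section NullSequences.
Variables (R : realType) (Fq : finFieldType)
  (K : fieldExtType {fraction {poly Fq}}) (C : Cinfty R K).
Local Notation cvg := (abs_cvg (Cabs C)).

Lemma cvg_cst (c : C) : cvg (fun=> c) c.
Proof. by move=> e e0; exists 0%N => n _; rewrite subrr cabs0. Qed.

Lemma eq_cvg (u v : nat -> C) l : u =1 v -> cvg u l -> cvg v l.
Proof. by move=> uv ul e /ul[N NP]; exists N => n /NP; rewrite uv. Qed.

Lemma cvgD (u v : nat -> C) l m :
  cvg u l -> cvg v m -> cvg (fun n => u n + v n) (l + m).
Proof.
move=> ul vm e e0; have [N NP] := ul e e0; have [M MP] := vm e e0.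
exists (maxn N M) => n; rewrite geq_max => /andP[/NP a /MP b].
by rewrite opprD addrACA; exact: cabsD_lt.
Qed.

Lemma cvg_sub0 (u : nat -> C) l : cvg u l <-> cvg (fun n => u n - l) 0.
Proof.
by split=> ul e /ul[N NP]; exists N => n /NP; rewrite subr0.
Qed.

Lemma cvg0M (u : nat -> C) c : cvg u 0 -> cvg (fun n => c * u n) 0.
Proof.
move=> u0 e e0; have [->|c0] := eqVneq c 0.
  by exists 0%N => n _; rewrite mul0r subrr cabs0.
have ac0 : 0 < Cabs C c.
  rewrite lt_def (abs_ge0 (CabsP C)) andbT; apply/eqP.
  by move=> /(abs_eq0 (CabsP C))/eqP; rewrite (negPf c0).
have [N NP] := u0 (e / Cabs C c) (divr_gt0 e0 ac0).
exists N => n /NP; rewrite !subr0 (absM (CabsP C)).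
by rewrite ltr_pdivlMr // mulrC.
Qed.

Lemma cvgM (u v : nat -> C) l m :
  cvg u l -> cvg v m -> cvg (fun n => u n * v n) (l * m).
Proof.
move=> /cvg_sub0 ul /cvg_sub0 vm; apply/cvg_sub0.
have uv0 : cvg (fun n => (u n - l) * (v n - m)) 0.
  move=> e e0; have [N NP] := ul e e0; have [M MP] := vm 1 ltr01.
  exists (maxn N M) => n; rewrite geq_max => /andP[/NP a /MP b].
  move: a b; rewrite !subr0 (absM (CabsP C)) => a b.
  rewrite (le_lt_trans _ a) // -[leRHS]mulr1.
  by rewrite ler_wpM2l ?(abs_ge0 (CabsP C)) ?ltW.
have := cvgD uv0 (cvgD (cvg0M m ul) (cvg0M l vm)); rewrite !addr0.
by apply: eq_cvg => n; ring.
Qed.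

Lemma cvg_mmap n (k : fieldType) (h : {rmorphism k -> C})
    (x : nat -> {ffun 'I_n -> C}) (l : {ffun 'I_n -> C}) (p : {mpoly k[n]}) :
  (forall j, cvg (fun i => x i j) (l j)) ->
  cvg (fun i => mmap h (x i) p) (mmap h l p).
Proof.
move=> xl; have cs (I : Type) (r : seq I) (F : I -> nat -> C) (G : I -> C) :
    (forall i, cvg (F i) (G i)) ->
    cvg (fun n => \sum_(i <- r) F i n) (\sum_(i <- r) G i).
  move=> FG; elim: r => [|i r IHr].
    by rewrite big_nil; apply: eq_cvg (cvg_cst 0) => j; rewrite big_nil.
  rewrite big_cons; apply: eq_cvg (cvgD (FG i) IHr) => j; rewrite big_cons //.
have cp (I : Type) (r : seq I) (F : I -> nat -> C) (G : I -> C) :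
    (forall i, cvg (F i) (G i)) ->
    cvg (fun n => \prod_(i <- r) F i n) (\prod_(i <- r) G i).
  move=> FG; elim: r => [|i r IHr].
    by rewrite big_nil; apply: eq_cvg (cvg_cst 1) => j; rewrite big_nil.
  rewrite big_cons; apply: eq_cvg (cvgM (FG i) IHr) => j; rewrite big_cons //.
rewrite /mmap; apply: (cs _ _ (fun M i => h p@_M * mmap1 (x i) M)) => M.
apply: cvgM (cvg_cst _) _; apply: (cp _ _ (fun j i => x i j ^+ M j)) => j.
elim: (M j) => [|b IHb]; first by apply: eq_cvg (cvg_cst 1).
by rewrite exprS; apply: eq_cvg (cvgM (xl j) IHb) => i; rewrite exprS.
Qed.

Lemma cvg0_qroot (u : nat -> C) : cvg u 0 -> cvg (fun n => qroot (u n)) 0.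
Proof.
move=> u0 e e0; have [N NP] := u0 (e ^+ #|Fq|) (exprn_gt0 _ e0).
exists N => n /NP; rewrite !subr0 -{1}(qrootK (u n)) cabsX.
by rewrite (ltr_pXn2r (q_gt0 Fq)) ?nnegrE ?(abs_ge0 (CabsP C)) ?ltW.
Qed.

Lemma cvg0_shift (u : nat -> C) : cvg u 0 -> cvg (shift u) 0.
Proof.
move=> u0 e /u0[N NP]; exists N.+1 => -[//|n]; rewrite ltnS; exact: NP.
Qed.
End NullSequences.

Section TateAlgebra.
Variables (R : realType) (Fq : finFieldType)
  (K : fieldExtType {fraction {poly Fq}}) (C : Cinfty R K).
Local Notation cvg := (abs_cvg (Cabs C)).

(* The power series over C converging on the closed unit disc, as a module    *)
(* over C[t].                                                                  *)
Definition tate_pred : {pred series C^o} := fun f => `[< forall z : C,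
  Cabs C z <= 1 -> exists l, cvg (fun n => \sum_(i < n) f i * z ^+ i) l >].

Lemma tate_predP (f : series C^o) : reflect (cvg f 0) (f \in tate_pred).
Proof.
apply: (iffP (asboolP _)) => [fC|f0 z z1].
  have [|l lP] := fC 1; first by rewrite cabs1.
  move=> e /lP[N NP]; exists N => n Nn; rewrite subr0.
  have -> : f n = (\sum_(i < n.+1) f i * 1 ^+ i - l)
                  - (\sum_(i < n) f i * 1 ^+ i - l).
    by rewrite big_ord_recr /= expr1n; ring.
  by apply: cabsD_lt; rewrite ?cabsN NP // leqW.
apply: Ccomplete => e e0; have [N NP] := f0 e e0; exists N.
have bd b m : (N <= m)%N ->
    Cabs C (\sum_(i < m + b) f i * z ^+ i - \sum_(i < m) f i * z ^+ i) < e.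
  move=> Nm; elim: b => [|b IHb]; first by rewrite addn0 subrr cabs0.
  rewrite addnS big_ord_recr /= addrAC; apply: cabsD_lt => //.
  have := NP (m + b)%N (leq_trans Nm (leq_addr _ _)); rewrite subr0.
  apply: le_lt_trans; rewrite (absM (CabsP C)) -[leRHS]mulr1 cabsX.
  by rewrite ler_wpM2l ?exprn_ile1 ?(abs_ge0 (CabsP C)).
move=> m n Nm Nn; have [mn|/ltnW nm] := leqP m n.
  by rewrite -cabsN opprB -(subnKC mn) bd.
by rewrite -(subnKC nm) bd.
Qed.

Lemma tate_closed : submod_closed tate_pred.
Proof.
split=> [|p f g /tate_predP f0 /tate_predP g0]; apply/tate_predP.
  exact: cvg_cst.
have it i : cvg (iter i (@shift C^o) f) 0.
  by elim: i => //= i IHi; exact: cvg0_shift.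
rewrite -[X in cvg _ X]addr0; apply: cvgD (g0).
rewrite -[p *: f]/(poly_scale _ _) /poly_scale.
elim: (size p) => [|n IHn].
  by apply: eq_cvg (cvg_cst 0) => i; rewrite big_ord0.
rewrite big_ord_recr /= -[X in cvg _ X]addr0; apply: cvgD IHn _.
exact: cvg0M.
Qed.
HB.instance Definition _ := GRing.isSubmodClosed.Build {poly C} (series C^o)
  tate_pred tate_closed.

Record tate := Tate { tate_val : series C^o; _ : tate_val \in tate_pred }.
HB.instance Definition _ := [isSub for tate_val].
HB.instance Definition _ := [Choice of tate by <:].
HB.instance Definition _ := [SubChoice_isSubLmodule of tate by <:].

Definition tcoef (f : tate) (i : nat) : C := tate_val f i.

Lemma tate_null (f : tate) : cvg (tcoef f) 0.
Proof. exact/tate_predP/(valP f). Qed.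

Definition sigma_coef (f : nat -> C^o) : nat -> C^o := fun i => qroot (f i : C).

Fact tsigma_subproof (f : tate) :
  (sigma_coef (tate_val f) : series C^o) \in tate_pred.
Proof. exact/tate_predP/cvg0_qroot/tate_null. Qed.
Definition tsigma (f : tate) : tate := Tate (tsigma_subproof f).

Fact sigma_coef_is_additive : zmod_morphism sigma_coef.
Proof. by move=> f g; apply/funext => i; exact: (raddfB (@qroot R Fq K C)). Qed.
HB.instance Definition _ := GRing.isZmodMorphism.Build (nat -> C^o)
  (nat -> C^o) sigma_coef sigma_coef_is_additive.

Fact tsigma_is_additive : zmod_morphism tsigma.
Proof. by move=> f g; apply: val_inj; exact: (raddfB sigma_coef). Qed.
HB.instance Definition _ := GRing.isZmodMorphism.Build tate tate tsigma
  tsigma_is_additive.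

Lemma tsigma_scale (p : {poly C}) (f : tate) :
  tsigma (p *: f) = map_poly (@qroot R Fq K C) p *: tsigma f.
Proof.
apply: val_inj.
apply: (polymod_semilinear (g := @qroot R Fq K C) (s := sigma_coef)).
  by move=> a v; apply/funext => i; exact: (rmorphM (@qroot R Fq K C)).
by move=> v; apply/funext => -[|i]; first exact: (raddf0 (@qroot R Fq K C)).
Qed.
End TateAlgebra.

Section PointModule.
Variables (R : realType) (Fq : finFieldType)
  (K : fieldExtType {fraction {poly Fq}}) (C : Cinfty R K) (d : nat).
Local Notation cvg := (abs_cvg (Cabs C)).

Definition Epts : Type :=
  restrict_scalars (constC C) {ffun 'I_d -> C^o}.
HB.instance Definition _ := GRing.Lmodule.on Epts.

Definition supnorm (e : Epts) : R := \big[Num.max/0]_(j < d) Cabs C (e j).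

Definition null_pts (e : nat -> Epts) : Prop :=
  forall eps : R, 0 < eps ->
    exists N, forall n, (N <= n)%N -> supnorm (e n) < eps.

Lemma null_ptsP (e : nat -> Epts) :
  null_pts e <-> forall j, cvg (fun n => e n j : C) 0.
Proof.
split=> [e0 j eps /e0[N NP]|e0 eps eps0].
  exists N => n /NP; rewrite subr0; apply: le_lt_trans.
  exact: (le_bigmax _ (fun j => Cabs C (e n j))).
have /choice[N NP] : forall j, exists N, forall n, (N <= n)%N ->
    Cabs C (e n j) < eps.
  by move=> j; have [N NP] := e0 j eps eps0; exists N => n /NP; rewrite subr0.
exists (\max_(j < d) N j) => n Nn; apply: bigmax_lt => // j _.
by apply: NP; apply: leq_trans Nn; exact: leq_bigmax.
Qed.

Definition Et_pred : {pred series Epts} := fun e => `[< null_pts e >].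

Lemma Et_closed : submod_closed Et_pred.
Proof.
split=> [|p f g /asboolP/null_ptsP f0 /asboolP/null_ptsP g0];
    apply/asboolP/null_ptsP => j.
  by apply: eq_cvg (cvg_cst (0 : C)) => i; rewrite [RHS]ffunE.
have it i : forall j, cvg (fun n => iter i (@shift Epts) f n j : C) 0.
  elim: i => [//|i IHi] j'; apply: eq_cvg (cvg0_shift (IHi j')) => -[|n] //=.
  by rewrite ffunE.
suff pf : cvg (fun n => (p *: f : series Epts) n j : C) 0.
  rewrite -[X in cvg _ X]addr0.
  by apply: eq_cvg (cvgD pf (g0 j)) => n; rewrite [RHS]ffunE.
rewrite -[p *: f]/(poly_scale _ _) /poly_scale.
elim: (size p) => [|n IHn].
  by apply: eq_cvg (cvg_cst (0 : C)) => i; rewrite big_ord0 [RHS]ffunE.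
rewrite big_ord_recr /= -[X in cvg _ X]addr0.
apply: eq_cvg (cvgD IHn (cvg0M (constC C p`_n) (it n j))) => i.
by rewrite [RHS]ffunE; congr (_ + _); rewrite [RHS]ffunE.
Qed.
HB.instance Definition _ := GRing.isSubmodClosed.Build {poly Fq} (series Epts)
  Et_pred Et_closed.

Record Et := MkEt { Et_val : series Epts; _ : Et_val \in Et_pred }.
HB.instance Definition _ := [isSub for Et_val].
HB.instance Definition _ := [Choice of Et by <:].
HB.instance Definition _ := [SubChoice_isSubLmodule of Et by <:].

Variable phi : tmodule K d.

Definition phi_pts (a : {poly Fq}) (e : Epts) : Epts :=
  eval_pts (Kin C) (phi a) (e : {ffun 'I_d -> C}).

Fact phi_pts_is_linear a : linear (phi_pts a).
Proof.
move=> c e e'; rewrite /phi_pts.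
apply: etrans (vhomD (Kin C) (phi a) _ _) _; congr (_ + _).
have sE (x : Epts) : c *: x = scale_pts (Kin C (constK K c)) (x : {ffun 'I_d -> C}).
  by apply/ffunP => j; rewrite !ffunE.
by rewrite !sE; exact: vhomZ.
Qed.
HB.instance Definition _ a := GRing.isLinear.Build Fq Epts Epts *:%R
  (phi_pts a) (phi_pts_is_linear a).

Definition phi_coef (e : nat -> Epts) : nat -> Epts := fun n => phi_pts 'X (e n).

Fact phi_coef_is_linear : linear phi_coef.
Proof. by move=> c e e'; apply/funext => n; exact: linearP. Qed.
HB.instance Definition _ := GRing.isLinear.Build Fq (nat -> Epts) (nat -> Epts)
  *:%R phi_coef phi_coef_is_linear.

Fact Et_phi_subproof (e : Et) : (phi_coef (Et_val e) : series Epts) \in Et_pred.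
Proof.
have /asboolP/null_ptsP e0 := valP e; apply/asboolP/null_ptsP => j.
have /ffunP/(_ j) z := vhom0 (Kin C) (phi 'X).
rewrite -[X in cvg _ X](_ : mmap (Kin C) (0 : {ffun 'I_d -> C}) (phi 'X j) = 0); last first.
  by rewrite -eval_ptsE z ffunE.
apply: eq_cvg (cvg_mmap (Kin C) (x := fun n => Et_val e n) (l := 0) _ _).
  by move=> n /=; rewrite -eval_ptsE.
by move=> i; rewrite ffunE; exact: e0.
Qed.
Definition Et_phi (e : Et) : Et := MkEt (Et_phi_subproof e).

Fact Et_phi_is_linear : linear Et_phi.
Proof.
move=> p e e'; apply: val_inj.
apply: etrans (raddfD phi_coef _ _) _; congr (_ + _).
have -> : p = map_poly idfun p by rewrite map_poly_id.
rewrite {1}map_poly_id //.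
apply: (polymod_semilinear (g := idfun) (s := phi_coef)).
  by move=> a v; apply/funext => i; exact: linearZ.
by move=> v; apply/funext => -[|i]; first exact: (raddf0 (phi_pts 'X)).
Qed.
HB.instance Definition _ := GRing.isLinear.Build {poly Fq} Et Et *:%R
  Et_phi Et_phi_is_linear.

Definition H_pred : {pred Et} := fun h => Et_phi h == 'X *: h.

Fact H_closed : submod_closed H_pred.
Proof.
split=> [|a h h' /eqP hH /eqP h'H]; apply/eqP; first by rewrite raddf0 scaler0.
by rewrite Et_phi_is_linear hH h'H scalerDr !scalerA (mulrC a).
Qed.
HB.instance Definition _ := GRing.isSubmodClosed.Build {poly Fq} Et
  H_pred H_closed.

Record H := MkH { H_val :> Et; _ : H_val \in H_pred }.
HB.instance Definition _ := [isSub for H_val].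
HB.instance Definition _ := [Choice of H by <:].
HB.instance Definition _ := [SubChoice_isSubLmodule of H by <:].

Definition MtensorC : Type :=
  tensor (@polyC C) (dmotive C phi) (tate C).
HB.instance Definition _ := GRing.Zmodule.on MtensorC.

Definition MtensorCt : Type :=
  tensor (idfun : {rmorphism {poly C} -> {poly C}}) (dmotive C phi) (tate C).
HB.instance Definition _ := GRing.Lmodule.on MtensorCt.

End PointModule.

Section Maps.
Variables (R : realType) (Fq : finFieldType)
  (K : fieldExtType {fraction {poly Fq}}) (C : Cinfty R K) (d : nat)
  (phi : tmodule K d).

Local Notation M := (dmotive C phi).
Local Notation T := (tate C).
Local Notation MC := (MtensorC C phi).
Local Notation MCt := (MtensorCt C phi).
Local Notation idC := (idfun : {rmorphism {poly C} -> {poly C}}).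

Definition mphi (m : M) : M := tm_act phi 'X (m : ga_hom C d).
Fact mphi_is_additive : zmod_morphism mphi.
Proof. by move=> m n; exact: (raddfB (tm_act phi 'X)). Qed.
HB.instance Definition _ := GRing.isZmodMorphism.Build M M mphi
  mphi_is_additive.

Lemma mphiE (m : M) : mphi m = 'X *: m.
Proof. exact: (esym (polymodX (u := tm_act phi 'X) m)). Qed.

Definition tX (f : T) : T := 'X *: f.
Fact tX_is_additive : zmod_morphism tX.
Proof. by move=> f g; exact: scalerBr. Qed.
HB.instance Definition _ := GRing.isZmodMorphism.Build T T tX tX_is_additive.

Fact phi_id_balanced : balanced (@polyC C)
  (fun (m : M) (f : T) => ptensor (@polyC C) (mphi m) f : MC).
Proof.
apply: (balanced_map (u := mphi) (v := idfun) (g := idfun)) => // c m /=.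
by rewrite !mphiE !scalerA mulrC.
Qed.
Definition phi_id : MC -> MC := tensor_lift phi_id_balanced.
HB.instance Definition _ := GRing.Additive.copy phi_id
  (tensor_lift phi_id_balanced).

Fact id_t_balanced : balanced (@polyC C)
  (fun (m : M) (f : T) => ptensor (@polyC C) m (tX f) : MC).
Proof.
apply: (balanced_map (u := idfun) (v := tX) (g := idfun)) => // c f /=.
by rewrite /tX !scalerA mulrC.
Qed.
Definition id_t : MC -> MC := tensor_lift id_t_balanced.
HB.instance Definition _ := GRing.Additive.copy id_t
  (tensor_lift id_t_balanced).

Definition phi_sub_t (x : MC) : MC := phi_id x - id_t x.
Fact phi_sub_t_is_additive : zmod_morphism phi_sub_t.
Proof.
move=> x y; rewrite /phi_sub_t.
have phiB : phi_id (x - y) = phi_id x - phi_id y by exact: raddfB.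
have tB : id_t (x - y) = id_t x - id_t y by exact: raddfB.
by rewrite phiB tB !opprD !opprK addrACA.
Qed.
HB.instance Definition _ := GRing.isZmodMorphism.Build MC MC phi_sub_t
  phi_sub_t_is_additive.

Fact sigma_balanced : balanced (@polyC C)
  (fun (m : M) (f : T) => ptensor (@polyC C) (msigma m) (tsigma f) : MC).
Proof.
apply: (balanced_map (u := @msigma _ _ _ C d phi) (v := @tsigma _ _ _ C)
  (g := @qroot _ _ _ C)) => c x /=.
  by rewrite msigma_scale map_polyC.
by rewrite tsigma_scale map_polyC.
Qed.
Definition sigma_sigma : MC -> MC := tensor_lift sigma_balanced.
HB.instance Definition _ := GRing.Additive.copy sigma_sigma
  (tensor_lift sigma_balanced).

Definition sigma_sub_id (x : MC) : MC := sigma_sigma x - x.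
Fact sigma_sub_id_is_additive : zmod_morphism sigma_sub_id.
Proof.
move=> x y; rewrite /sigma_sub_id.
have sB : sigma_sigma (x - y) = sigma_sigma x - sigma_sigma y by exact: raddfB.
by rewrite sB !opprD !opprK addrACA.
Qed.
HB.instance Definition _ := GRing.isZmodMorphism.Build MC MC sigma_sub_id
  sigma_sub_id_is_additive.

Definition ev1 (m : M) : Epts C d :=
  eval_pts idfun (m : vhom _ _ _) [ffun=> 1 : C].

(* The constant c of C[t] acts on M as precomposition with c, so (f_i)%:P *: m  *)
(* is the product written f_i m for the C-vector space M.                      *)
Fact ev1t_subproof (m : M) (f : T) :
  ((fun i => ev1 ((tcoef f i)%:P *: m)) : series (Epts C d)) \in @Et_pred _ _ _ C d.
Proof.
have evE i : ev1 ((tcoef f i)%:P *: m) =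
    eval_pts idfun (m : vhom _ _ _) [ffun=> tcoef f i].
  rewrite /ev1 [_ *: m]polymodC eval_ga_hom_scale; congr (eval_pts _ _ _).
  by apply/ffunP => j; rewrite !ffunE mulr1.
apply/asboolP/null_ptsP => j.
have /ffunP/(_ j) z := vhom0 (S := C) idfun (m : vhom _ _ _).
rewrite -[X in abs_cvg _ _ X](_ : mmap idfun (0 : {ffun 'I_1 -> C})
  ((m : vhom _ _ _) j) = 0); last by rewrite -eval_ptsE z ffunE.
apply: eq_cvg (cvg_mmap (C := C) idfun (x := fun n => [ffun=> tcoef f n])
  (l := 0) _ _).
  by move=> n /=; rewrite evE eval_ptsE.
by move=> i; rewrite ffunE; apply: eq_cvg (tate_null f) => n; rewrite ffunE.
Qed.
Definition ev1t_pure (m : M) (f : T) : Et C d := MkEt (ev1t_subproof m f).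

Fact ev1_is_additive : zmod_morphism ev1.
Proof.
suff sD : {morph ev1 : m n / m + n}.
  have s0 : ev1 0 = 0 by apply: (addrI (ev1 0)); rewrite -sD !addr0.
  have sN m : ev1 (- m) = - ev1 m.
    by apply: (addrI (ev1 m)); rewrite -sD !subrr s0.
  by move=> m n; rewrite sD sN.
by move=> m n; exact: eval_vhomD.
Qed.
HB.instance Definition _ := GRing.isZmodMorphism.Build M (Epts C d) ev1
  ev1_is_additive.

Fact ev1t_balanced : balanced (@polyC C) ev1t_pure.
Proof.
split=> [m m' f|m f f'|c m f]; apply: val_inj; apply/funext => i.
- by rewrite /= scalerDr raddfD.
- rewrite -[LHS]/(ev1 ((tcoef (f + f') i)%:P *: m)).
  by rewrite -[tcoef _ i]/(tcoef f i + tcoef f' i) polyCD scalerDl raddfD.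
rewrite /= scalerA -polyCM; congr (ev1 (_%:P *: m)); rewrite mulrC.
by rewrite /tcoef; have /(congr1 (@^~ i)) := polymodC (u := @shift C^o) c (tate_val f).
Qed.
Definition ev1t : MC -> Et C d := tensor_lift ev1t_balanced.
HB.instance Definition _ := GRing.Additive.copy ev1t
  (tensor_lift ev1t_balanced).

Fact proj_balanced : balanced (@polyC C)
  (fun (m : M) (f : T) => ptensor idC m f : MCt).
Proof.
by apply: (balanced_map (u := idfun) (v := idfun) (g := @polyC C)).
Qed.
Definition proj_Ct : MC -> MCt := tensor_lift proj_balanced.
HB.instance Definition _ := GRing.Additive.copy proj_Ct
  (tensor_lift proj_balanced).

Fact sigma_Ct_balanced : balanced idC
  (fun (m : M) (f : T) => ptensor idC (msigma m) (tsigma f) : MCt).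
Proof.
apply: (balanced_map (u := @msigma _ _ _ C d phi) (v := @tsigma _ _ _ C)
  (g := map_poly (@qroot _ _ _ C))) => p x /=.
  exact: msigma_scale.
exact: tsigma_scale.
Qed.
Definition sigma_Ct : MCt -> MCt := tensor_lift sigma_Ct_balanced.
HB.instance Definition _ := GRing.Additive.copy sigma_Ct
  (tensor_lift sigma_Ct_balanced).

Definition MCt_Fq : Type :=
  restrict_scalars (map_poly (constC C) : {rmorphism {poly Fq} -> {poly C}}) MCt.
HB.instance Definition _ := GRing.Lmodule.on MCt_Fq.

Definition sigma_fixed : {pred MCt_Fq} := fun z => sigma_Ct z == z.

Lemma sigma_CtD : {morph sigma_Ct : x y / x + y}.
Proof. exact: raddfD. Qed.

Lemma sigma_Ct_scale (p : {poly C}) (z : MCt) :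
  sigma_Ct (p *: z) = map_poly (@qroot _ _ _ C) p *: sigma_Ct z.
Proof.
elim/tensor_ind: z => [m f|x y IHx IHy]; last first.
  by rewrite scalerDr !sigma_CtD IHx IHy scalerDr.
by rewrite scale_ptensor /sigma_Ct !tensor_liftE scale_ptensor msigma_scale.
Qed.

Fact sigma_fixed_closed : submod_closed sigma_fixed.
Proof.
split=> [|a x y /eqP xP /eqP yP]; apply/eqP; first exact: raddf0 sigma_Ct.
apply: etrans (sigma_CtD _ _) _; rewrite yP; congr (_ + _).
apply: etrans (sigma_Ct_scale _ _) _; rewrite xP; congr (_ *: _).
by rewrite -map_poly_comp; apply: eq_map_poly => c; exact: qroot_const.
Qed.
HB.instance Definition _ := GRing.isSubmodClosed.Build {poly Fq} MCt_Fq
  sigma_fixed sigma_fixed_closed.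

Record MCt_sigma := MkMCtSigma {
  MCt_sigma_val : MCt_Fq;
  _ : MCt_sigma_val \in sigma_fixed
}.
HB.instance Definition _ := [isSub for MCt_sigma_val].
HB.instance Definition _ := [Choice of MCt_sigma by <:].
HB.instance Definition _ := [SubChoice_isSubLmodule of MCt_sigma by <:].
End Maps.

Arguments phi_sub_t {R Fq K} C {d} phi.
Arguments sigma_sub_id {R Fq K} C {d} phi.
Arguments ev1t {R Fq K} C {d} phi.
Arguments proj_Ct {R Fq K} C {d} phi.
Arguments Et_phi {R Fq K} C {d} phi.
Arguments MCt_sigma {R Fq K} C {d} phi.
Arguments H {R Fq K} C {d} phi.

Definition is_cokernel (U V W : zmodType) (f : {additive U -> V})
    (p : {additive V -> W}) : Prop :=
  (forall w, exists v, p v = w) /\ (forall v, p v = 0 <-> exists u, f u = v).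

Definition short_exact (U V W : zmodType) (f : {additive U -> V})
    (g : {additive V -> W}) : Prop :=
  injective f /\ is_cokernel f g.

(* Main.v *)
(* An F_q-linear morphism G_a -> G_a is a polynomial in the Frobenius tau, so   *)
(* the dual motive is a C-vector space with basis tau^i e_j, and an element of *)
(* its tensor product with the Tate algebra T is a finite sum of pure tensors  *)
(* tau^i e_j (x) f_ij with unique f_ij in T. The operator sigma moves f_ij to  *)
(* sigma(f_ij) on tau^(i+1) e_j: hence sigma - 1 is injective, and modulo its  *)
(* image only the tau^0 e_j (x) g_j survive, which evaluation at 1 identifies  *)
(* with E<t>. Injectivity of phi_t - t is read off coefficient by coefficient  *)
(* in t from that of phi_t, whose differential is invertible because it is the *)
(* sum of theta and a nilpotent. The cokernel of phi_t - t is obtained by      *)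
(* comparing the relations which define the two tensor products. The           *)
(* isomorphism is then the connecting map of the snake lemma; it is            *)
(* F_q[t]-linear because F_q[t] also acts on everything through T.             *)
From HB Require Import structures.
Require Import Defs.
From mathcomp Require Import all_boot all_order all_algebra all_solvable all_field.
From mathcomp Require Import boolp functions reals.
From mathcomp Require Import freeg mpoly.
Set Implicit Arguments.
Unset Strict Implicit.
Unset Printing Implicit Defensive.
Import Order.TTheory GRing.Theory Num.Theory.
Local Open Scope ring_scope.
Local Open Scope quotient_scope.

(** An element x of the tensor product over C is described in two ways. By [upoly_coef_eq0] only the
    exponents q^i occur in an F_q-linear map out of G_a, so x is a finite sum of terms tau^i e_j (x)
    f_ij ([coordT_sum]). It also has a coefficient x_n in the dual motive at each t^n ([coefT]).
    Either family determines x ([coordT_eq0], [coefT_eq0]).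

    The row is exact by the first description. Since sigma raises i by one, a fixed point of sigma
    has all f_ij = 0 ([sigma_sub_id_inj]); modulo the image of sigma - 1 every term moves to i = 0
    ([sigma_reduce]), where evaluation just reads off the f_0j ([ev1t_ker], [ev1t_surj]). The second
    description turns (phi_t - t)x = 0 into phi_t x_0 = 0 and phi_t x_(n+1) = x_n, so x = 0 by
    [dmotive_X_inj]. The cokernel is found by showing that every relation of balancing over C[t]
    follows from the one for t, modulo those over C ([phi_sub_t_scale], [proj_Ct_ker]).

    In the snake sequence the kernel of the middle vertical map is then 0, that of the right one is
    H, and the map between the first two cokernels is induced by sigma - 1. So the connecting map
    sends H bijectively onto the sigma-fixed classes ([snake_eq0], [snake_surj]). *)

(** * Exponents of additive F_q-linear monomials *)

Lemma coef_add1X_exp (k : comNzRingType) n i :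
  ((1 + 'X) ^+ n : {poly k})`_i = 'C(n, i)%:R.
Proof.
rewrite exprDn coef_sum.
under eq_bigr do rewrite expr1n mul1r coefMn coefXn.
have [le_in|lt_ni] := leqP i n.
  rewrite (bigD1 (Ordinal (le_in : (i < n.+1)%N))) //= eqxx big1 ?addr0 // => j.
  by rewrite -val_eqE /= eq_sym => /negPf->; rewrite mul0rn.
rewrite bin_small // big1 // => j _.
by rewrite gtn_eqF ?mul0rn // (leq_trans _ lt_ni) // ltnS -ltnS.
Qed.

(** Write n = r s with s the p-part of n. In characteristic p, (1 + X)^n = (1 + X^s)^r, whose
    coefficient at X^s is r, nonzero in k. If r > 1 then 0 < s < n, against the hypothesis. *)
Lemma pow_of_bin_eq0 (k : fieldType) p n : p \in [pchar k] -> (0 < n)%N ->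
    (forall i, (0 < i < n)%N -> 'C(n, i)%:R = 0 :> k) ->
  exists e, n = (p ^ e)%N.
Proof.
move=> pk n0 bin0; have p_pr := pcharf_prime pk.
have [r cop nE] := pfactor_coprime p_pr n0; exists (logn p n).
set s := (p ^ _)%N in nE *.
have s0 : (0 < s)%N by rewrite expn_gt0 prime_gt0.
have r0 : (0 < r)%N by move: n0; rewrite nE muln_gt0 => /andP[].
move: r0; rewrite leq_eqVlt => /orP[/eqP r1|r1]; first by rewrite nE -r1 mul1n.
have sn : (0 < s < n)%N by rewrite s0 nE -{1}[s]mul1n ltn_pmul2r.
have := bin0 s sn.
rewrite -coef_add1X_exp nE mulnC exprM exprDn_pchar; last first.
  by rewrite (eq_pnat _ (pcharf_eq (rmorph_pchar polyC pk))) pnatX pnat_id.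
have -> : ((1 ^+ s + 'X^s) ^+ r : {poly k}) = ((1 + 'X) ^+ r) \Po 'X^s.
  by rewrite rmorphXn rmorphD /= comp_polyX rmorph1 expr1n.
rewrite coef_comp_poly_Xn // dvdnn divnn s0 coef_add1X_exp bin1 => /eqP.
by rewrite -(dvdn_pcharf pk) => pr; move: cop; rewrite prime_coprime // pr.
Qed.

(* The hypotheses say that X^n is additive and F_q-linear over k. Additivity   *)
(* gives n = p^e, and the residue of e mod log_p q must vanish since X^(p^b)-X *)
(* has at most p^b roots.                                                      *)
Lemma pow_card_of_bin_eq0 (F : finFieldType) (k : fieldType)
    (h : {rmorphism F -> k}) n : (0 < n)%N ->
    (forall i, (0 < i < n)%N -> 'C(n, i)%:R = 0 :> k) ->
    (forall c : F, h c ^+ n = h c) ->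
  exists i, n = (#|F| ^ i)%N.
Proof.
move=> n0 bin0 powc; have [p p_pr pF] := finPcharP F.
have [e nE] := pow_of_bin_eq0 (rmorph_pchar h pF) n0 bin0.
have [f qE] : {f | #|F| = (p ^ f)%N}.
  apply: p_natP; have := pchar_q (idfun : {rmorphism F -> F}).
  by rewrite (eq_pnat _ (pcharf_eq pF)).
have f0 : (0 < f)%N.
  rewrite lt0n; apply: contraTneq (finNzRing_gt1 F) => f0.
  by rewrite qE f0.
exists (e %/ f)%N; set b := (e %% f)%N.
have nE' : n = (#|F| ^ (e %/ f) * p ^ b)%N.
  by rewrite nE qE -expnM -expnD mulnC -divn_eq.
have powb c : c ^+ (p ^ b) = c :> F.
  apply: (fmorph_inj h); rewrite rmorphXn -[RHS]powc nE' exprM; congr (_ ^+ _).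
  rewrite -rmorphXn; congr (h _).
  by elim: (e %/ f)%N => [|i IHi] //; rewrite expnS exprM expf_card.
have [b0|b0] := posnP b; first by rewrite nE' b0 muln1.
have pb1 : (1 < p ^ b)%N by rewrite -{1}(expn0 p) ltn_exp2l ?prime_gt1.
have sz : size ('X^(p ^ b) - 'X : {poly F}) = (p ^ b).+1.
  by rewrite size_polyDl ?size_polyXn // size_polyN size_polyX ltnS.
have nz : 'X^(p ^ b) - 'X != 0 :> {poly F} by rewrite -size_poly_eq0 sz.
have rts : all (root ('X^(p ^ b) - 'X)) (enum F).
  by apply/allP => c _; rewrite rootE !hornerE powb subrr.
have := max_poly_roots nz rts (enum_uniq F).
by rewrite sz -cardT ltnS leqNgt qE ltn_exp2l ?prime_gt1 // ltn_mod f0.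
Qed.

(** * Homomorphisms out of G_a as polynomials in one variable *)

Lemma coef_comp_scaleX (k : comNzRingType) (P : {poly k}) c n :
  (P \Po (c *: 'X))`_n = P`_n * c ^+ n.
Proof.
rewrite coef_comp_poly.
under eq_bigr do rewrite exprZn coefZ coefXn.
have [le_Pn|lt_nP] := leqP (size P) n.
  rewrite nth_default // mul0r big1 // => i _.
  by rewrite gtn_eqF ?mulr0 // (leq_trans (ltn_ord i)).
rewrite (bigD1 (Ordinal lt_nP)) //= eqxx mulr1 big1 ?addr0 // => i.
by rewrite -val_eqE /= eq_sym => /negPf->; rewrite !mulr0.
Qed.

Section UnivariateHoms.
Variables (Fq : finFieldType) (k : fieldType) (eta : {rmorphism Fq -> k}).
Local Notation q := #|Fq|.

(** The j-th coordinate as an ordinary polynomial, obtained as the value of f at the point X of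
    G_a(k[X]). By [eval_upoly] it determines f on all points. *)
Definition upoly m (f : {ffun 'I_m -> {mpoly k[1]}}) (j : 'I_m) : {poly k} :=
  eval_pts (@polyC k) f [ffun=> 'X] j.

Lemma eval_upoly m (f : {ffun 'I_m -> {mpoly k[1]}}) (S : comNzRingType)
    (h : {rmorphism k -> S}) x j :
  eval_pts h f x j = (map_poly h (upoly f j)).[x ord0].
Proof.
have cx : commr_rmorph h (x ord0) by move=> c; exact: mulrC.
have := eval_pts_natural (@polyC k) (horner_morph cx) f [ffun=> 'X].
move/ffunP/(_ j).
rewrite ffunE -[LHS]/(map_poly h (upoly f j)).[x ord0] => ->.
have -> : [ffun i => horner_morph cx ([ffun=> 'X] i)] = x.
  by apply/ffunP => i; rewrite !ffunE horner_morphX (ord1 i).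
by rewrite (eq_eval_pts (h' := h)) // => c /=; rewrite horner_morphC.
Qed.

Lemma upoly_inj m (f g : vhom eta 1 m) : upoly f =1 upoly g -> f = g.
Proof.
move=> fg; apply: vhom_eq => S h x; apply/ffunP => j.
by rewrite !eval_upoly fg.
Qed.

Lemma upolyD m (f g : vhom eta 1 m) j : upoly (f + g) j = upoly f j + upoly g j.
Proof. by rewrite /upoly eval_vhomD ffunE. Qed.

Lemma upoly0 m j : upoly (0 : vhom eta 1 m) j = 0.
Proof.
by apply: (addrI (upoly (0 : vhom eta 1 m) j)); rewrite -upolyD !addr0.
Qed.

Lemma upoly_coef0 m (f : vhom eta 1 m) j : (upoly f j)`_0 = 0.
Proof.
have /ffunP/(_ j) := vhom0 (idfun : {rmorphism k -> k}) f.
by rewrite eval_upoly map_poly_id // !ffunE horner_coef0.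
Qed.

(* Compare coefficients of Y^i in the two sides of P(X + Y) = P(X) + P(Y). *)
Lemma upoly_bin m (f : vhom eta 1 m) j n i : (0 < i < n)%N ->
  (upoly f j)`_n * 'C(n, i)%:R = 0.
Proof.
case/andP=> i0 i_lt_n; set P := upoly f j.
have [/(nth_default 0)->|n_lt_P] := leqP (size P) n; first by rewrite mul0r.
have := vhomD (@polyC {poly k} \o @polyC k) f [ffun=> 'X%:P] [ffun=> 'X].
move/ffunP/(_ j); rewrite ffunE !eval_upoly !ffunE -/P.
rewrite nderiv_taylor; last exact: mulrC.
have mapXE (A : comNzRingType) (Q : {poly A}) : (map_poly polyC Q).['X] = Q.
  exact: comp_polyXr.
have mapE (Q : {poly k}) :
    (map_poly (@polyC {poly k} \o @polyC k) Q).['X%:P] = Q%:P.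
  by rewrite map_poly_comp horner_map mapXE.
rewrite [X in _ = X + _ -> _](mapE P).
rewrite [X in _ = _ + X -> _](_ : _ = map_poly polyC P); last first.
  by rewrite map_poly_comp mapXE.
(* The coefficient of Y^i X^(n-i): as 0 < i < n, neither P(X) nor P(Y) contributes to it. *)
move/(congr1 (fun Q : {poly {poly k}} => Q`_i`_(n - i))).
rewrite !coefD coef_map coefC gtn_eqF // coef0.
rewrite [_%:P`_(n - i)]coefC subn_eq0 leqNgt i_lt_n add0r.
rewrite coef_sum.
under eq_bigr => l _ do rewrite nderivn_map mapE coefCM coefXn.
rewrite [size _](_ : _ = size P) ?map_poly_comp ?size_map_polyC //.
rewrite (bigD1 (Ordinal (ltn_trans i_lt_n n_lt_P))) //=.
rewrite eqxx mulr1 big1 ?addr0 => [|l]; last first.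
  by rewrite -val_eqE eq_sym /= => /negPf->; rewrite mulr0.
by rewrite coef_nderivn subnKC ?(ltnW i_lt_n) // mulr_natr.
Qed.

(** If the coefficient at X^n is nonzero it can be cancelled: additivity then kills the intermediate
    binomials of n, and P(cX) = cP(X) gives c^n = c on F_q. *)
Lemma upoly_coef_eq0 m (f : vhom eta 1 m) j n :
  (upoly f j)`_n != 0 -> exists i, n = (q ^ i)%N.
Proof.
move=> fn.
apply: (pow_card_of_bin_eq0 (h := eta)) => [|i /(upoly_bin f j)/eqP|c].
- by rewrite lt0n; apply: contraNneq fn => ->; rewrite upoly_coef0.
- by rewrite mulf_eq0 (negPf fn) => /eqP.
have /ffunP/(_ j) := vhomZ (@polyC k) f c [ffun=> 'X].
rewrite eval_upoly !ffunE -/(_ \Po _) => /(congr1 (fun Q : {poly k} => Q`_n)).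
rewrite !mul_polyC coef_comp_scaleX coefZ -[eval_pts _ _ _ _]/(upoly f j).
by rewrite [RHS]mulrC => /(mulfI fn).
Qed.
End UnivariateHoms.

(** * The basis tau^i e_j of the dual motive *)

Section DualMotiveBasis.
Variables (R : realType) (Fq : finFieldType)
  (K : fieldExtType {fraction {poly Fq}}) (C : Cinfty R K) (d : nat)
  (phi : tmodule K d).
Local Notation q := #|Fq|.
Local Notation M := (dmotive C phi).
Local Notation vM := (vhom (constC C) 1 d).
Local Notation qroot := (@qroot R Fq K C).
Implicit Types m : M.

Lemma iter_qrootB i (x y : C) :
  iter i qroot (x - y) = iter i qroot x - iter i qroot y.
Proof. by elim: i => //= i ->; rewrite rmorphB. Qed.

Lemma iter_qroot0 i : iter i qroot 0 = 0.
Proof. by elim: i => //= i ->; rewrite rmorph0. Qed.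

Lemma iter_qrootM i (x y : C) :
  iter i qroot (x * y) = iter i qroot x * iter i qroot y.
Proof. by elim: i => //= i ->; rewrite rmorphM. Qed.

Lemma iter_qrootX i (x : C) : iter i qroot (x ^+ (q ^ i)) = x.
Proof. by elim: i => [|i IHi] //; rewrite iterSr expnSr exprM expqK. Qed.

Lemma iter_qroot_eq0 i (x : C) : iter i qroot x = 0 -> x = 0.
Proof.
elim: i => //= i IHi /(congr1 (fun y => y ^+ q)).
by rewrite qrootK expr0n gtn_eqF ?q_gt0.
Qed.

(* The coordinate of m on tau^i in the j-th copy of G_a: since C acts by       *)
(* precomposition, c . tau^i is c^(q^i) tau^i, hence the roots.                *)
Definition mcoord j i (m : M) : C :=
  iter i qroot (upoly (m : vM) j)`_(q ^ i).

Fact mcoord_is_additive j i : zmod_morphism (mcoord j i).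
Proof.
move=> m n; rewrite /mcoord -iter_qrootB; congr (iter _ _ _).
apply: (addIr (upoly (n : vM) j)`_(q ^ i)); rewrite -coefD -upolyD.
by rewrite [_ + (n : vM)](subrK n m) subrK.
Qed.
HB.instance Definition _ j i := GRing.isZmodMorphism.Build M C (mcoord j i)
  (mcoord_is_additive j i).

Lemma mcoordZ j i c m : mcoord j i (c%:P *: m) = c * mcoord j i m.
Proof.
have -> : c%:P *: m = ga_hom_scale c m :> ga_hom C d by exact: polymodC.
rewrite /mcoord /upoly eval_ga_hom_scale eval_upoly !ffunE mul_polyC.
rewrite -/(_ \Po _) coef_comp_scaleX iter_qrootM iter_qrootX.
by rewrite mulrC.
Qed.

Lemma upoly_msigma j m : upoly (msigma m : vM) j = upoly (m : vM) j \Po 'X^q.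
Proof. by rewrite /upoly eval_msigma eval_upoly !ffunE. Qed.

Lemma mcoord_msigma0 j m : mcoord j 0 (msigma m) = 0.
Proof.
rewrite /mcoord upoly_msigma coef_comp_poly_Xn ?q_gt0 //= expn0 dvdn1.
by rewrite gtn_eqF ?finNzRing_gt1.
Qed.

Lemma mcoord_msigmaS j i m : mcoord j i.+1 (msigma m) = qroot (mcoord j i m).
Proof.
rewrite /mcoord upoly_msigma coef_comp_poly_Xn ?q_gt0 //= expnS dvdn_mulr //.
by rewrite mulKn ?q_gt0.
Qed.

(** No coefficient is missed, since those at exponents other than the q^i vanish; and iterated q-th
    roots are injective. *)
Lemma mcoord_inj m (n : M) : (forall j i, mcoord j i m = mcoord j i n) -> m = n.
Proof.
move=> mn; apply/eqP; rewrite -subr_eq0; apply/eqP.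
apply: upoly_inj => j; rewrite upoly0; apply/polyP => l; rewrite coef0.
apply: contrapT => /eqP cl; have [i li] := upoly_coef_eq0 cl.
case/eqP: cl; rewrite li; apply: (@iter_qroot_eq0 i).
by rewrite -[LHS]/(mcoord j i (m - n)) mcoord_is_additive mn subrr.
Qed.

Lemma mcoord_bound m : exists N, forall j i, (N <= i)%N -> mcoord j i m = 0.
Proof.
exists (\max_(j < d) size (upoly (m : vM) j)) => j i le_Ni.
rewrite /mcoord nth_default ?iter_qroot0 //.
apply: leq_trans (leq_bigmax j) (leq_trans le_Ni _).
by rewrite ltnW // ltn_expl // finNzRing_gt1.
Qed.

Fact mbasis0_is_vhom (j : 'I_d) :
  is_vhom (constC C) [ffun l => (l == j)%:R *: 'X_ord0 : {mpoly C[1]}].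
Proof.
have E (S : comNzRingType) (h : {rmorphism C -> S}) (x : {ffun 'I_1 -> S}) :
    eval_pts h [ffun l => (l == j)%:R *: 'X_ord0 : {mpoly C[1]}] x =
    [ffun l : 'I_d => (l == j)%:R * x ord0].
  apply/ffunP => l; rewrite eval_ptsE !ffunE mmapZ mmapX mmap1U.
  by rewrite -[h _]/(h (_ == _)%:R) rmorph_nat.
move=> S h; split=> [x y|b x]; rewrite !E; apply/ffunP => l.
  by rewrite !ffunE mulrDr.
by rewrite !ffunE mulrCA.
Qed.
Definition mbasis0 j : M := mk_vhom (mbasis0_is_vhom j).
(** The element tau^i e_j: [mbasis0 j] is the inclusion of G_a as j-th factor, and sigma is
    precomposition with tau. *)
Definition mbasis j i : M := iter i (@msigma _ _ _ C d phi) (mbasis0 j).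

Lemma upoly_mbasis0 j l : upoly (mbasis0 j : vM) l = (l == j)%:R *: 'X.
Proof.
rewrite /upoly eval_ptsE /= ffunE mmapZ mmapX mmap1U ffunE.
by rewrite -mul_polyC.
Qed.

Lemma mcoord_mbasis j i l n :
  mcoord l n (mbasis j i) = ((l == j) && (n == i))%:R.
Proof.
elim: i n => [|i IHi] [|n].
- by rewrite /mcoord /= upoly_mbasis0 coefZ coefX expn0 mulr1 andbT.
- rewrite /mcoord upoly_mbasis0 coefZ coefX gtn_eqF.
    by rewrite mulr0 andbF iter_qroot0.
  by rewrite -[X in (X < _)%N](expn0 q) ltn_exp2l // finNzRing_gt1.
- by rewrite mcoord_msigma0 andbF.
by rewrite mcoord_msigmaS IHi rmorph_nat.
Qed.

Lemma mbasis_sum m N : (forall j i, (N <= i)%N -> mcoord j i m = 0) ->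
  m = \sum_(j < d) \sum_(i < N) (mcoord j i m)%:P *: mbasis j i.
Proof.
move=> mN; apply: mcoord_inj => l n; rewrite raddf_sum (bigD1 l) //=.
rewrite [X in _ + X]big1 => [|j jl]; last first.
  rewrite raddf_sum big1 // => i _ /=.
  by rewrite mcoordZ mcoord_mbasis eq_sym (negPf jl) mulr0.
rewrite addr0 raddf_sum; have [nN|Nn] := ltnP n N; last first.
  rewrite mN // big1 // => i _ /=; rewrite mcoordZ mcoord_mbasis.
  by rewrite gtn_eqF ?andbF ?mulr0 // (leq_trans (ltn_ord i)).
rewrite (bigD1 (Ordinal nN)) //= big1 => [|i].
  by rewrite /= mcoordZ mcoord_mbasis !eqxx mulr1 addr0.
rewrite -val_eqE /= => ni.
by rewrite mcoordZ mcoord_mbasis eq_sym (negPf ni) andbF mulr0.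
Qed.
End DualMotiveBasis.

(** * Coordinates and t-coefficients on the tensor product over C *)

Section TensorCoordinates.
Variables (R : realType) (Fq : finFieldType)
  (K : fieldExtType {fraction {poly Fq}}) (C : Cinfty R K) (d : nat)
  (phi : tmodule K d).
Local Notation M := (dmotive C phi).
Local Notation T := (tate C).
Local Notation MC := (MtensorC C phi).
Implicit Types (m : M) (f g : T) (x y : MC).

Lemma tcoefZ c f n : tcoef (c%:P *: f) n = c * tcoef f n.
Proof. exact: (congr1 (@^~ n) (polymodC (u := @shift C^o) c (tate_val f))). Qed.

Lemma tcoef0X f : tcoef ('X *: f) 0 = 0.
Proof. exact: (congr1 (@^~ 0%N) (polymodX (u := @shift C^o) (tate_val f))). Qed.

Lemma tcoefSX f n : tcoef ('X *: f) n.+1 = tcoef f n.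
Proof.
exact: (congr1 (@^~ n.+1) (polymodX (u := @shift C^o) (tate_val f))).
Qed.

Lemma tate_eqP f g : (forall n, tcoef f n = tcoef g n) -> f = g.
Proof. by move=> fg; apply: val_inj; apply/funext. Qed.

Definition pureC m f : MC := ptensor (@polyC C) m f.

Lemma pureCDl m m' f : pureC (m + m') f = pureC m f + pureC m' f.
Proof. exact: ptensorDl. Qed.

Lemma pureCDr m f f' : pureC m (f + f') = pureC m f + pureC m f'.
Proof. exact: ptensorDr. Qed.

Lemma pureCZ c m f : pureC (c%:P *: m) f = pureC m (c%:P *: f).
Proof. exact: ptensorZ. Qed.

Lemma pureC0l f : pureC 0 f = 0.
Proof. by apply: (addrI (pureC 0 f)); rewrite -pureCDl !addr0. Qed.

Lemma pureC0r m : pureC m 0 = 0.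
Proof. by apply: (addrI (pureC m 0)); rewrite -pureCDr !addr0. Qed.

Lemma pureC_suml (I : Type) (r : seq I) (F : I -> M) f :
  pureC (\sum_(i <- r) F i) f = \sum_(i <- r) pureC (F i) f.
Proof.
by apply: (big_morph (pureC^~ f)) => [m m'|]; rewrite ?pureCDl ?pureC0l.
Qed.

Lemma pureC_ind (P : MC -> Prop) :
  (forall m f, P (pureC m f)) -> (forall x y, P x -> P y -> P (x + y)) ->
  forall x, P x.
Proof. exact: tensor_ind. Qed.

Lemma eq_pureC (V : zmodType) (g h : {additive MC -> V}) :
  (forall m f, g (pureC m f) = h (pureC m f)) -> g =1 h.
Proof. by move=> gh; elim/pureC_ind => // x y Hx Hy; rewrite !raddfD Hx Hy. Qed.

Fact coordT_balanced j i : balanced (@polyC C)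
  (fun m f => (mcoord j i m)%:P *: f : T).
Proof.
split=> [m m' f|m f f'|c m f]; first by rewrite raddfD polyCD scalerDl.
  exact: scalerDr.
by rewrite mcoordZ !scalerA -!polyCM mulrC.
Qed.
Definition coordT j i : MC -> T := tensor_lift (coordT_balanced j i).
HB.instance Definition _ j i := GRing.Additive.copy (coordT j i)
  (tensor_lift (coordT_balanced j i)).

Lemma coordTE j i m f : coordT j i (pureC m f) = (mcoord j i m)%:P *: f.
Proof. exact: tensor_liftE. Qed.

Fact coefT_balanced n : balanced (@polyC C)
  (fun m f => (tcoef f n)%:P *: m : M).
Proof.
split=> [m m' f|m f f'|c m f]; first exact: scalerDr.
  by rewrite -scalerDl -polyCD.
by rewrite tcoefZ !scalerA -!polyCM mulrC.
Qed.
Definition coefT n : MC -> M := tensor_lift (coefT_balanced n).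
HB.instance Definition _ n := GRing.Additive.copy (coefT n)
  (tensor_lift (coefT_balanced n)).

Lemma coefTE n m f : coefT n (pureC m f) = (tcoef f n)%:P *: m.
Proof. exact: tensor_liftE. Qed.

Lemma tcoef_coordT j i n x : tcoef (coordT j i x) n = mcoord j i (coefT n x).
Proof.
elim/pureC_ind: x => [m f|x y IHx IHy].
  by rewrite coordTE coefTE tcoefZ mcoordZ mulrC.
by rewrite !raddfD /= -IHx -IHy.
Qed.

(** Allowing every larger N' makes the statement stable under sums, where two expansions need a
    common length. *)
Lemma coordT_sum x : exists N, forall N', (N <= N')%N ->
  x = \sum_(j < d) \sum_(i < N') pureC (mbasis C phi j i) (coordT j i x).
Proof.
elim/pureC_ind: x => [m f|x y [N xN] [N' yN']].
  have [N mN] := mcoord_bound m; exists N => N' NN'.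
  rewrite {1}(@mbasis_sum _ _ _ _ _ _ m N'); last first.
    by move=> j i /(leq_trans NN'); exact: mN.
  rewrite pureC_suml; apply: eq_bigr => j _.
  rewrite pureC_suml; apply: eq_bigr => i _.
  by rewrite pureCZ coordTE.
exists (maxn N N') => L; rewrite geq_max => /andP[/xN xL /yN' yL].
rewrite {1}xL {1}yL -big_split; apply: eq_bigr => j _.
rewrite -big_split; apply: eq_bigr => i _.
by rewrite raddfD pureCDr.
Qed.

Lemma coordT_eq0 x : (forall j i, coordT j i x = 0) -> x = 0.
Proof.
move=> x0; have [N /(_ N (leqnn N))->] := coordT_sum x.
by rewrite big1 // => j _; rewrite big1 // => i _; rewrite x0 pureC0r.
Qed.

Lemma coefT_eq0 x : (forall n, coefT n x = 0) -> x = 0.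
Proof.
move=> x0; apply: coordT_eq0 => j i; apply: tate_eqP => n.
by rewrite tcoef_coordT x0 raddf0.
Qed.
End TensorCoordinates.

(** * Injectivity of phi_t on the dual motive *)

Lemma meval0 (A : comNzRingType) n (p : {mpoly A[n]}) : p.@[fun=> 0] = p@_0%MM.
Proof.
elim/mpolyind: p => [|c m p _ _ IHp]; first by rewrite meval0 mcoeff0.
rewrite mevalD mcoeffD IHp mevalZ mcoeffZ mcoeffX mevalX; congr (_ * _ + _).
have [->|m0] := eqVneq m 0%MM; first by rewrite big1 // => i _; rewrite mnm0E.
have /existsP[i mi] : [exists i, m i != 0%N].
  apply: contraR m0; rewrite negb_exists => /forallP m0; apply/eqP/mnmP => i.
  by rewrite mnm0E; apply/eqP; rewrite -[_ == _]negbK.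
by rewrite (bigD1 i) //= expr0n (negPf mi) mul0r.
Qed.

Lemma jacobian0E (k : fieldType) n m (f : {ffun 'I_m -> {mpoly k[n]}}) i j :
  jacobian0 f i j = (f i)@_U_(j).
Proof. by rewrite mxE meval0 mcoeff_deriv mnm0E mulr1n add0m. Qed.

(** A monomial of degree e takes a value divisible by X^(ne). For n > 0 the constant term lives in
    degree 0 and those with e > 1 start beyond X^n, so only the linear part of F is seen. *)
Lemma mmap_lowest_coef (k A : fieldType) (h : {rmorphism k -> A}) d n
    (F : {mpoly k[d]}) (v : 'I_d -> {poly A}) : (0 < n)%N ->
  (mmap (@polyC A \o h) (fun i => v i * 'X^n) F)`_n =
  \sum_(i < d) h F@_U_(i) * (v i)`_0.
Proof.
move=> n0; elim/mpolyind: F => [|c m p _ _ IHp].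
  by rewrite mmap0 coef0 big1 // => i _; rewrite mcoeff0 rmorph0 mul0r.
rewrite mmapD coefD IHp mmapZ mmapX coefCM.
under [RHS]eq_bigr do
  rewrite mcoeffD mcoeffZ mcoeffX rmorphD rmorphM mulrDl -mulrA.
rewrite big_split -mulr_sumr; congr (_ * _ + _); rewrite /mmap1.
have -> : \prod_(i < d) (v i * 'X^n) ^+ m i =
    (\prod_(i < d) v i ^+ m i) * 'X^(n * mdeg m).
  under eq_bigr do rewrite exprMn -exprM.
  by rewrite big_split mdegE big_distrr /= prodrXr.
rewrite coefMXn; have [m0|m_gt0] := posnP (mdeg m).
  have /eqP -> : m == 0%MM by rewrite -mdeg_eq0 m0.
  rewrite mdeg0 muln0 /= subn0 big1 => [|i _]; last by rewrite mnm0E.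
  rewrite coef1 gtn_eqF // big1 // => i _.
  by rewrite eq_sym mnm1_eq0 rmorph0 mul0r.
have [m1|m_neq1] := eqVneq (mdeg m) 1%N.
  have /mdeg1P[l /eqP ->] : mdeg m == 1%N by rewrite m1.
  rewrite mdeg1 muln1 ltnn subnn.
  rewrite (bigD1 l) //= [in RHS](bigD1 l) //= mnm1E !eqxx mulr1n rmorph1 mul1r.
  rewrite big1 => [|i il]; last by rewrite mnm1E eq_sym (negPf il).
  rewrite mulr1 expr1 big1 ?addr0 // => i il.
  by rewrite eq_mnm1 eq_sym (negPf il) rmorph0 mul0r.
have m_gt1 : (1 < mdeg m)%N by rewrite ltn_neqAle eq_sym m_neq1.
rewrite ltn_Pmulr // big1 // => i _.
have [mi|_] := eqVneq m U_(i)%MM; last by rewrite rmorph0 mul0r.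
by rewrite mi mdeg1 in m_neq1.
Qed.

Section Injectivity.
Variables (R : realType) (Fq : finFieldType)
  (K : fieldExtType {fraction {poly Fq}}) (C : Cinfty R K) (d : nat)
  (phi : tmodule K d).
Local Notation M := (dmotive C phi).
Local Notation vM := (vhom (constC C) 1 d).

Lemma theta_neq0 : Kin C (theta K) != 0.
Proof.
apply/eqP => t0; have := Cabs_theta C; rewrite t0 cabs0 => /esym/eqP.
by rewrite pnatr_eq0 gtn_eqF ?q_gt0.
Qed.

(** On the kernel of the differential its nilpotent part acts as the scalar -theta, and theta is
    nonzero because its absolute value is q. *)
Lemma jacobian_inj (w : 'cV[C]_d) :
  map_mx (Kin C) (jacobian0 (phi 'X)) *m w = 0 -> w = 0.
Proof.
move=> Aw; have [n Nn] := tm_nilpotent phi.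
set N := jacobian0 _ - _ in Nn.
have Nw : map_mx (Kin C) N *m w = - Kin C (theta K) *: w.
  by rewrite map_mxB mulmxBl Aw map_scalar_mx mul_scalar_mx sub0r scaleNr.
have NXw e : map_mx (Kin C) (N ^+ e) *m w = (- Kin C (theta K)) ^+ e *: w.
  elim: e => [|e IHe]; first by rewrite !expr0 map_mx1 mul1mx scale1r.
  by rewrite exprSr map_mxM -mulmxA Nw -scalemxAr IHe scalerA -exprS.
have /eqP := NXw n; rewrite Nn map_mx0 mul0mx eq_sym scaler_eq0.
by rewrite expf_eq0 oppr_eq0 (negPf theta_neq0) andbF => /eqP.
Qed.

(* The lowest-order coefficient of phi_t o m is the invertible differential of *)
(* phi_t applied to that of m.                                                 *)
Lemma dmotive_X_inj (m : M) : 'X *: m = 0 -> m = 0.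
Proof.
rewrite -mphiE => m0; pose P j := upoly (m : vM) j.
have evP j : mmap (@polyC C \o Kin C) P (phi 'X j) = 0.
  have <- : upoly (mphi m : vM) j = 0 by rewrite m0 upoly0.
  by rewrite /upoly eval_tm_act_pts eval_ptsE.
have P0 n : forall j, (P j)`_n = 0.
  elim/ltn_ind: n => -[|n] IHn j; first exact: upoly_coef0.
  (* By induction all coefficients of index at most n vanish, so X^(n+1) divides every
     coordinate. *)
  have PE l : P l = drop_poly n.+1 (P l) * 'X^(n.+1).
    rewrite -[LHS](poly_take_drop n.+1) [take_poly _ _](_ : _ = 0) ?add0r //.
    apply/polyP => i; rewrite coef_take_poly coef0.
    by case: ltnP => // /IHn ->.
  pose w := \col_l (drop_poly n.+1 (P l))`_0.
  suff /matrixP/(_ j 0) : w = 0 by rewrite !mxE coef_drop_poly.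
  apply: jacobian_inj; apply/matrixP => l z; rewrite !mxE.
  rewrite -[RHS](coef0 C n.+1) -(evP l) (funext PE) mmap_lowest_coef //.
  by apply: eq_bigr => i _; rewrite [map_mx _ _ _ _]mxE jacobian0E mxE.
apply: upoly_inj => j; rewrite upoly0; apply/polyP => n.
by rewrite coef0; exact: P0.
Qed.
End Injectivity.

(** * Commutation of the maps, and injectivity of phi_t - t and sigma - 1 *)

Section Rows.
Variables (R : realType) (Fq : finFieldType)
  (K : fieldExtType {fraction {poly Fq}}) (C : Cinfty R K) (d : nat)
  (phi : tmodule K d).
Local Notation M := (dmotive C phi).
Local Notation T := (tate C).
Local Notation MC := (MtensorC C phi).
Local Notation MCt := (MtensorCt C phi).
Local Notation idC := (idfun : {rmorphism {poly C} -> {poly C}}).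
Implicit Types (m : M) (f g : T) (x y : MC).

Lemma phi_idE m f : phi_id (pureC m f) = pureC ('X *: m) f.
Proof. by rewrite /phi_id tensor_liftE mphiE. Qed.

Lemma id_tE m f : id_t (pureC m f) = pureC m ('X *: f).
Proof. exact: tensor_liftE. Qed.

Lemma sigma_sigmaE m f : sigma_sigma (pureC m f) = pureC (msigma m) (tsigma f).
Proof. exact: tensor_liftE. Qed.

Lemma ev1tE m f : ev1t C phi (pureC m f) = ev1t_pure m f.
Proof. exact: tensor_liftE. Qed.

Lemma proj_CtE m f : proj_Ct C phi (pureC m f) = ptensor idC m f.
Proof. exact: tensor_liftE. Qed.

Lemma sigma_CtE m f :
  sigma_Ct (ptensor idC m f : MCt) = ptensor idC (msigma m) (tsigma f).
Proof. exact: tensor_liftE. Qed.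

Lemma phi_sub_tE m f :
  phi_sub_t C phi (pureC m f) = pureC ('X *: m) f - pureC m ('X *: f).
Proof. by rewrite /phi_sub_t phi_idE id_tE. Qed.

Lemma sigma_sub_idE m f :
  sigma_sub_id C phi (pureC m f) = pureC (msigma m) (tsigma f) - pureC m f.
Proof. by rewrite /sigma_sub_id sigma_sigmaE. Qed.

Lemma coefT0_phi_sub_t x : coefT 0 (phi_sub_t C phi x) = 'X *: coefT 0 x.
Proof.
move: x; apply: (eq_pureC (g := coefT 0 \o phi_sub_t C phi)
  (h := GRing.scale 'X \o coefT 0)) => m f /=.
rewrite phi_sub_tE raddfB /= !coefTE tcoef0X scale0r subr0.
by rewrite !scalerA mulrC.
Qed.

Lemma coefTS_phi_sub_t n x :
  coefT n.+1 (phi_sub_t C phi x) = 'X *: coefT n.+1 x - coefT n x.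
Proof.
move: x; apply: (eq_pureC (g := coefT n.+1 \o phi_sub_t C phi)
  (h := (GRing.scale 'X \o coefT n.+1) \- coefT n)) => m f /=.
by rewrite phi_sub_tE raddfB /= !coefTE tcoefSX !scalerA mulrC.
Qed.

Lemma phi_sub_t_inj : injective (phi_sub_t C phi).
Proof.
apply: raddf_inj => x x0; apply: coefT_eq0 => n.
elim: n => [|n IHn]; apply: dmotive_X_inj.
  by rewrite -coefT0_phi_sub_t x0 raddf0.
by rewrite -[LHS]subr0 -IHn -coefTS_phi_sub_t x0 raddf0.
Qed.

Lemma coordT0_sigma j x : coordT j 0 (sigma_sigma x) = 0.
Proof.
move: x; apply: (eq_pureC (g := coordT j 0 \o @sigma_sigma _ _ _ C d phi)
  (h := \0)) => m f /=.
by rewrite sigma_sigmaE coordTE mcoord_msigma0 scale0r.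
Qed.

Lemma coordTS_sigma j i x :
  coordT j i.+1 (sigma_sigma x) = tsigma (coordT j i x).
Proof.
move: x; apply: (eq_pureC (g := coordT j i.+1 \o @sigma_sigma _ _ _ C d phi)
  (h := @tsigma _ _ _ C \o coordT j i)) => m f /=.
by rewrite sigma_sigmaE !coordTE mcoord_msigmaS tsigma_scale map_polyC.
Qed.

Lemma sigma_sub_id_inj : injective (sigma_sub_id C phi).
Proof.
apply: raddf_inj => x /eqP; rewrite subr_eq0 => /eqP sx.
apply: coordT_eq0 => j i; elim: i => [|i IHi].
  by rewrite -sx coordT0_sigma.
by rewrite -sx coordTS_sigma IHi raddf0.
Qed.

Lemma phi_sub_t_sigma x : phi_sub_t C phi (sigma_sub_id C phi x) =
  sigma_sub_id C phi (phi_sub_t C phi x).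
Proof.
move: x; apply: (eq_pureC (g := phi_sub_t C phi \o sigma_sub_id C phi)
  (h := sigma_sub_id C phi \o phi_sub_t C phi)) => m f /=.
rewrite phi_sub_tE sigma_sub_idE phi_sub_t_is_additive sigma_sub_id_is_additive.
rewrite !phi_sub_tE !sigma_sub_idE msigma_scale tsigma_scale map_polyX.
rewrite !opprB addrACA [RHS]addrACA; congr (_ + _); exact: addrC.
Qed.

Lemma proj_Ct_phi_sub_t x : proj_Ct C phi (phi_sub_t C phi x) = 0.
Proof.
move: x; apply: (eq_pureC (g := proj_Ct C phi \o phi_sub_t C phi)
  (h := \0)) => m f /=.
rewrite phi_sub_tE raddfB /= !proj_CtE; apply/eqP; rewrite subr_eq0; apply/eqP.
exact: (ptensorZ idC).
Qed.

Lemma proj_Ct_sigma x :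
  proj_Ct C phi (sigma_sigma x) = sigma_Ct (proj_Ct C phi x).
Proof.
move: x; apply: (eq_pureC (g := proj_Ct C phi \o @sigma_sigma _ _ _ C d phi)
  (h := @sigma_Ct _ _ _ C d phi \o proj_Ct C phi)) => m f /=.
by rewrite sigma_sigmaE !proj_CtE sigma_CtE.
Qed.

Lemma proj_Ct_surj z : exists x, proj_Ct C phi x = z.
Proof.
elim/tensor_ind: z => [m f|z z' [x <-] [x' <-]].
  by exists (pureC m f); rewrite proj_CtE.
by exists (x + x'); rewrite raddfD.
Qed.
End Rows.

(** * The cokernel of phi_t - t *)

Section TensorKernel.
Variables (B A : comNzRingType) (h : {rmorphism B -> A}) (M N : lmodType A).

(** This allows induction on the relations that make a formal sum vanish in the tensor product. *)
Lemma pi_tensor_eq0 x : \pi_(tensor h M N) x = 0 -> tensor_relation h x.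
Proof.
move=> x0; apply/asboolP; rewrite -[asbool _]/(_ \in @tensor_rel B A h M N).
rewrite -[x]subr0 Quotient.idealrBE; apply/eqP.
by rewrite [LHS]x0; apply/esym; exact: (raddf0 (\pi_(tensor h M N))).
Qed.

Lemma fglift_ptensor x :
  fglift (fun u => ptensor h u.1 u.2 : zmodule (tensor h M N)) x =
  \pi_(tensor h M N) x.
Proof.
have bal : balanced h (fun m n => ptensor h m n : tensor h M N).
  by split; [exact: ptensorDl|exact: ptensorDr|exact: ptensorZ].
rewrite -(tensor_lift_pi bal).
apply: (tensor_eq (g := tensor_lift bal) (h := idfun)) => m n.
exact: tensor_liftE.
Qed.
End TensorKernel.

Section Cokernel.
Variables (R : realType) (Fq : finFieldType)
  (K : fieldExtType {fraction {poly Fq}}) (C : Cinfty R K) (d : nat)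
  (phi : tmodule K d).
Local Notation M := (dmotive C phi).
Local Notation T := (tate C).
Local Notation MC := (MtensorC C phi).
Local Notation idC := (idfun : {rmorphism {poly C} -> {poly C}}).
Implicit Types (m : M) (f g : T) (x y : MC).

Lemma phi_sub_t_scale (b : {poly C}) m f :
  exists u, phi_sub_t C phi u = pureC (b *: m) f - pureC m (b *: f).
Proof.
elim/poly_ind: b => [|b c IHb] in m f *.
  by exists 0; rewrite !scale0r pureC0l pureC0r subrr raddf0.
(* Telescoping through tm (x) bf: [u] accounts for btm (x) f - tm (x) bf, and the added pure tensor
   for tm (x) bf - m (x) tbf. The constant c passes across already over C. *)
have [u uE] := IHb ('X *: m) f; exists (u + pureC m (b *: f)).
rewrite !scalerDl pureCDl pureCDr pureCZ opprD addrACA subrr addr0.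
have -> : phi_sub_t C phi (u + pureC m (b *: f)) =
    phi_sub_t C phi u + phi_sub_t C phi (pureC m (b *: f)).
  exact: (raddfD (phi_sub_t C phi)).
by rewrite uE phi_sub_tE addrA subrK !scalerA (mulrC 'X).
Qed.

(** Lift x to a formal sum, which is then a relation over C[t]. The biadditivity relations already
    vanish over C, and the scaling ones are images by [phi_sub_t_scale]. *)
Lemma proj_Ct_ker x : proj_Ct C phi x = 0 -> exists u, phi_sub_t C phi u = x.
Proof.
elim/quotW: x => x; rewrite /proj_Ct tensor_lift_pi fglift_ptensor.
move/pi_tensor_eq0; elim=> {x} [|x y _ [u ux] _ [v vy]|m m' f|m f f'|b m f].
- exists 0; rewrite raddf0; apply/esym; exact: raddf0.
- exists (u - v); rewrite phi_sub_t_is_additive ux vy.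
  by apply/esym; exact: (raddfB (\pi_(tensor (@polyC C) M T))).
- exists 0; rewrite raddf0; apply/esym/pi_tensor_rel/Tensor_relDl.
- exists 0; rewrite raddf0; apply/esym/pi_tensor_rel/Tensor_relDr.
have [u uE] := phi_sub_t_scale b m f; exists u; rewrite uE.
by apply/esym; exact: (raddfB (\pi_(tensor (@polyC C) M T))).
Qed.
End Cokernel.

(** * Evaluation at 1 and exactness of the row *)

Section Evaluation.
Variables (R : realType) (Fq : finFieldType)
  (K : fieldExtType {fraction {poly Fq}}) (C : Cinfty R K) (d : nat)
  (phi : tmodule K d).
Local Notation q := #|Fq|.
Local Notation M := (dmotive C phi).
Local Notation T := (tate C).
Local Notation MC := (MtensorC C phi).
Local Notation vM := (vhom (constC C) 1 d).
Implicit Types (m : M) (f g : T) (x y : MC) (e : Et C d).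

Lemma Et_eqP e e' : (forall n, Et_val e n = Et_val e' n) -> e = e'.
Proof. by move=> ee'; apply: val_inj; apply/funext. Qed.

Lemma Et_val0X e : Et_val ('X *: e) 0 = 0.
Proof.
exact: (congr1 (@^~ 0%N) (polymodX (u := @shift (Epts C d)) (Et_val e))).
Qed.

Lemma Et_valSX e n : Et_val ('X *: e) n.+1 = Et_val e n.
Proof.
exact: (congr1 (@^~ n.+1) (polymodX (u := @shift (Epts C d)) (Et_val e))).
Qed.

Lemma EtD_val e e' n : Et_val (e + e') n = Et_val e n + Et_val e' n.
Proof. by []. Qed.

Lemma ev1_scale c m l : ev1 (c%:P *: m) l = (upoly (m : vM) l).[c].
Proof.
rewrite /ev1 [_ *: m]polymodC eval_ga_hom_scale eval_upoly map_poly_id //.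
by rewrite !ffunE mulr1.
Qed.

Lemma ev1_X m : ev1 ('X *: m) = phi_pts phi 'X (ev1 m).
Proof.
rewrite -mphiE /ev1 eval_tm_act_pts /phi_pts.
exact: eq_eval_pts.
Qed.

Lemma ev1_msigma m : ev1 (msigma m) = ev1 m.
Proof.
rewrite /ev1 eval_msigma; congr (eval_pts _ _ _).
by apply/ffunP => l; rewrite !ffunE expr1n.
Qed.

(** Coefficientwise, sigma(f_n) sigma(m) = sigma(f_n m), and precomposing with tau does not change
    the value at 1 since 1^q = 1. *)
Lemma ev1t_sigma x : ev1t C phi (sigma_sub_id C phi x) = 0.
Proof.
move: x; apply: (eq_pureC (g := ev1t C phi \o sigma_sub_id C phi)
  (h := \0)) => m f /=.
rewrite sigma_sub_idE raddfB /= !ev1tE; apply/eqP; rewrite subr_eq0; apply/eqP.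
apply: Et_eqP => n; rewrite -[LHS]/(ev1 ((qroot (tcoef f n))%:P *: msigma m)).
rewrite -[RHS]/(ev1 ((tcoef f n)%:P *: m)) -[RHS]ev1_msigma.
by rewrite msigma_scale map_polyC.
Qed.

Lemma ev1t_phi_sub_t x : ev1t C phi (phi_sub_t C phi x) =
  Et_phi C phi (ev1t C phi x) - 'X *: ev1t C phi x.
Proof.
move: x; apply: (eq_pureC (g := ev1t C phi \o phi_sub_t C phi)
  (h := (Et_phi C phi \o ev1t C phi) \- (GRing.scale 'X \o ev1t C phi))).
move=> m f /=.
rewrite phi_sub_tE raddfB /= !ev1tE; congr (_ - _); apply: Et_eqP => n.
  rewrite -[LHS]/(ev1 ((tcoef f n)%:P *: ('X *: m))).
  rewrite -[RHS]/(phi_pts phi 'X (ev1 ((tcoef f n)%:P *: m))) -ev1_X.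
  by rewrite !scalerA mulrC.
rewrite -[LHS]/(ev1 ((tcoef ('X *: f) n)%:P *: m)).
case: n => [|n]; last by rewrite Et_valSX tcoefSX.
by rewrite Et_val0X tcoef0X scale0r raddf0.
Qed.

Lemma ev1t_mbasis0 (g : 'I_d -> T) n l :
  Et_val (ev1t C phi (\sum_j pureC (mbasis0 C phi j) (g j))) n l =
  tcoef (g l) n.
Proof.
rewrite raddf_sum /=.
have -> : Et_val (\sum_j ev1t C phi (pureC (mbasis0 C phi j) (g j))) n l =
  \sum_j Et_val (ev1t C phi (pureC (mbasis0 C phi j) (g j))) n l.
  elim/big_rec2: _ => [|j y1 y2 _ <-]; first by rewrite [LHS]ffunE.
  by rewrite EtD_val [LHS]ffunE.
rewrite (bigD1 l) //= big1 => [|j jl]; rewrite ev1tE.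
  rewrite [X in X + 0 = _]ev1_scale.
  by rewrite upoly_mbasis0 eqxx scale1r hornerX addr0.
rewrite [LHS]ev1_scale.
by rewrite upoly_mbasis0 eq_sym (negPf jl) scale0r horner0.
Qed.

Fact Et_row_subproof e (j : 'I_d) :
  ((fun n => Et_val e n j) : series C^o) \in @tate_pred _ _ _ C.
Proof. by apply/tate_predP; have /asboolP/null_ptsP := valP e; apply. Qed.
Definition Et_row e j : T := Tate (Et_row_subproof e j).

Lemma ev1t_surj e : exists x, ev1t C phi x = e.
Proof.
exists (\sum_j pureC (mbasis0 C phi j) (Et_row e j)).
by apply: Et_eqP => n; apply/ffunP => l; rewrite ev1t_mbasis0.
Qed.

Fact tfrob_subproof f :
  ((fun n => tcoef f n ^+ q) : series C^o) \in @tate_pred _ _ _ C.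
Proof.
have cvgX b : abs_cvg (Cabs C) (fun n => tcoef f n ^+ b) (0 ^+ b).
  elim: b => [|b IHb]; first exact: cvg_cst.
  by rewrite exprS; apply: eq_cvg (cvgM (tate_null f) IHb) => n; rewrite exprS.
by apply/tate_predP; have := cvgX q; rewrite expr0n gtn_eqF ?q_gt0.
Qed.
(** A right inverse of sigma on T, needed to write any tau^(i+1) e_j (x) f as an image under
    sigma. *)
Definition tfrob f : T := Tate (tfrob_subproof f).

Lemma tfrobK f : tsigma (tfrob f) = f.
Proof. by apply: tate_eqP => n; exact: expqK. Qed.

(* Modulo the image of sigma - 1, tau^i (x) f is tau^0 (x) f^(q^i).            *)
Lemma sigma_reduce x : exists y (g : 'I_d -> T),
  x = sigma_sub_id C phi y + \sum_j pureC (mbasis0 C phi j) (g j).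
Proof.
pose P x := exists y (g : 'I_d -> T),
  x = sigma_sub_id C phi y + \sum_j pureC (mbasis0 C phi j) (g j).
have P0 : P 0.
  exists 0, (fun=> 0); rewrite raddf0 add0r big1 // => j _; exact: pureC0r.
have PD : forall x y, P x -> P y -> P (x + y).
  move=> _ _ [y [g ->]] [y' [g' ->]]; exists (y + y'), (fun j => g j + g' j).
  rewrite addrACA; congr (_ + _).
    by apply/esym; exact: (raddfD (sigma_sub_id C phi)).
  by rewrite -big_split; apply: eq_bigr => j _; rewrite pureCDr.
have [N /(_ N (leqnn N))->] := coordT_sum x.
apply: (big_ind P) => // j _; apply: (big_ind P) => // i _.
move: (coordT j i x) => f; elim: {i}(i : nat) f => [|i IHi] f.
  exists 0, (fun l => if l == j then f else 0).
  rewrite raddf0 add0r (bigD1 j) //= eqxx big1 ?addr0 // => l /negPf->.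
  exact: pureC0r.
have -> : pureC (mbasis C phi j i.+1) f =
    sigma_sub_id C phi (pureC (mbasis C phi j i) (tfrob f)) +
    pureC (mbasis C phi j i) (tfrob f).
  by rewrite sigma_sub_idE tfrobK subrK.
apply: PD (IHi _); exists (pureC (mbasis C phi j i) (tfrob f)), (fun=> 0).
by rewrite big1 ?addr0 // => l _; exact: pureC0r.
Qed.

Lemma ev1t_ker x : ev1t C phi x = 0 -> exists y, sigma_sub_id C phi y = x.
Proof.
have [y [g ->]] := sigma_reduce x.
rewrite [ev1t _ _ _](raddfD (ev1t C phi)) [X in X + _]ev1t_sigma add0r => g0.
exists y.
rewrite big1 ?addr0 // => j _; rewrite [g j](_ : _ = 0) ?pureC0r //.
by apply: tate_eqP => n; rewrite -ev1t_mbasis0 g0 [LHS]ffunE.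
Qed.
End Evaluation.

(** * The connecting map and its F_q[t]-linearity *)

Section Snake.
Variables (R : realType) (Fq : finFieldType)
  (K : fieldExtType {fraction {poly Fq}}) (C : Cinfty R K) (d : nat)
  (phi : tmodule K d).
Local Notation M := (dmotive C phi).
Local Notation T := (tate C).
Local Notation MC := (MtensorC C phi).
Local Notation MCt := (MtensorCt C phi).
Local Notation vM := (vhom (constC C) 1 d).
Local Notation polyC_of := (map_poly (constC C)).
Local Notation phi_t := (phi_sub_t C phi).
Local Notation sigma_1 := (sigma_sub_id C phi).
Implicit Types (m : M) (f g : T) (x y : MC) (e : Et C d) (a : {poly Fq}).

Fact scaleT_balanced (p : {poly C}) : balanced (@polyC C)
  (fun m f => pureC m (p *: f) : MC).
Proof.
split=> [m m' f|m f f'|c m f]; first exact: pureCDl.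
  by rewrite scalerDr pureCDr.
by rewrite pureCZ !scalerA mulrC.
Qed.
(** The action through the factor T. Unlike the one through the left factor, under which t becomes
    phi_t on E<t>, it induces the shift by t there. *)
Definition scaleT p : MC -> MC := tensor_lift (scaleT_balanced p).
HB.instance Definition _ p := GRing.Additive.copy (scaleT p)
  (tensor_lift (scaleT_balanced p)).

Lemma scaleTE p m f : scaleT p (pureC m f) = pureC m (p *: f).
Proof. exact: tensor_liftE. Qed.

Lemma phi_sub_t_scaleT p x : phi_t (scaleT p x) = scaleT p (phi_t x).
Proof.
move: x; apply: (eq_pureC (g := phi_t \o scaleT p) (h := scaleT p \o phi_t)).
move=> m f /=; rewrite phi_sub_tE raddfB /= !scaleTE phi_sub_tE.
by rewrite !scalerA mulrC.
Qed.

(** Coefficients in F_q are required here: they are their own q-th roots. *)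
Lemma sigma_sub_id_scaleT a x :
  sigma_1 (scaleT (polyC_of a) x) = scaleT (polyC_of a) (sigma_1 x).
Proof.
move: x; apply: (eq_pureC (g := sigma_1 \o scaleT (polyC_of a))
  (h := scaleT (polyC_of a) \o sigma_1)) => m f /=.
rewrite sigma_sub_idE raddfB /= !scaleTE sigma_sub_idE tsigma_scale.
rewrite -map_poly_comp; congr (pureC _ (_ *: _) - _).
by apply: eq_map_poly => c; exact: qroot_const.
Qed.

Lemma proj_Ct_scaleT p x : proj_Ct C phi (scaleT p x) = p *: proj_Ct C phi x.
Proof.
move: x; apply: (eq_pureC (g := proj_Ct C phi \o scaleT p)
  (h := GRing.scale p \o proj_Ct C phi)) => m f /=.
rewrite scaleTE !proj_CtE scale_ptensor.
by apply/esym; exact: (ptensorZ idfun).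
Qed.

Lemma ev1_constC c m : ev1 ((constC C c)%:P *: m) = c *: ev1 m.
Proof.
rewrite /ev1 [_ *: m]polymodC eval_ga_hom_scale.
by rewrite (vhomZ (idfun : {rmorphism C -> C}) (m : vM) c).
Qed.

Lemma ev1t_pure_scale a m f :
  ev1t_pure m (polyC_of a *: f) = a *: ev1t_pure m f.
Proof.
have ev1t_pureD g h : ev1t_pure m (g + h) = ev1t_pure m g + ev1t_pure m h.
  by rewrite -!ev1tE pureCDr; exact: (raddfD (ev1t C phi)).
have ev1t_pureX g : ev1t_pure m ('X *: g) = 'X *: ev1t_pure m g.
  apply: Et_eqP => n; rewrite -[LHS]/(ev1 ((tcoef ('X *: g) n)%:P *: m)).
  case: n => [|n]; last by rewrite Et_valSX tcoefSX.
  by rewrite Et_val0X tcoef0X scale0r raddf0.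
have ev1t_pureC c g :
    ev1t_pure m ((constC C c)%:P *: g) = c%:P *: ev1t_pure m g.
  apply: Et_eqP => n.
  rewrite -[LHS]/(ev1 ((tcoef ((constC C c)%:P *: g) n)%:P *: m)).
  rewrite tcoefZ polyCM -scalerA ev1_constC; apply/esym.
  exact: (congr1 (@^~ n) (polymodC (u := @shift (Epts C d)) c _)).
elim/poly_ind: a => [|a c IHa] in f *.
  by rewrite rmorph0 !scale0r -ev1tE pureC0r raddf0.
rewrite rmorphD rmorphM /= map_polyX map_polyC !scalerDl ev1t_pureD ev1t_pureC.
by rewrite -[in LHS]scalerA (IHa ('X *: f)) ev1t_pureX scalerA.
Qed.

Lemma ev1t_scaleT a x :
  ev1t C phi (scaleT (polyC_of a) x) = a *: ev1t C phi x.
Proof.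
move: x; apply: (eq_pureC (g := ev1t C phi \o scaleT (polyC_of a))
  (h := GRing.scale a \o ev1t C phi)) => m f /=.
by rewrite scaleTE !ev1tE ev1t_pure_scale.
Qed.

Lemma proj_CtB x y : proj_Ct C phi (x - y) = proj_Ct C phi x - proj_Ct C phi y.
Proof. by rewrite raddfB. Qed.

(** The connecting map as a relation, so that linearity and independence of the lift are proved
    before any choice is made. *)
Definition snake e (z : MCt) := exists x y,
  [/\ ev1t C phi x = e, phi_t x = sigma_1 y & proj_Ct C phi y = z].

(** Two lifts of e differ by (sigma - 1)w, hence the two y by (phi_t - t)w, which dies in the
    cokernel. *)
Lemma snake_unique e z z' : snake e z -> snake e z' -> z = z'.
Proof.
move=> [x [y [xe xy <-]]] [x' [y' [x'e xy' <-]]].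
have [w wE] : exists w, sigma_1 w = x - x'.
  by apply: ev1t_ker; rewrite raddfB /= xe x'e subrr.
apply/eqP; rewrite -subr_eq0 -proj_CtB; apply/eqP.
suff -> : y - y' = phi_t w by exact: proj_Ct_phi_sub_t.
apply: sigma_sub_id_inj; rewrite -phi_sub_t_sigma wE.
by rewrite sigma_sub_id_is_additive phi_sub_t_is_additive xy xy'.
Qed.

Lemma snake_linear a e e' (z z' : MCt) : snake e z -> snake e' z' ->
  snake (a *: e + e') (polyC_of a *: z + z').
Proof.
move=> [x [y [<- xy <-]]] [x' [y' [<- xy' <-]]].
exists (scaleT (polyC_of a) x + x'), (scaleT (polyC_of a) y + y'); split.
- by rewrite [LHS](raddfD (ev1t C phi)) /= ev1t_scaleT.
- rewrite [LHS](raddfD phi_t) [RHS](raddfD sigma_1) /=.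
  by rewrite phi_sub_t_scaleT sigma_sub_id_scaleT xy xy'.
by rewrite [LHS](raddfD (proj_Ct C phi)) /= proj_Ct_scaleT.
Qed.

Lemma snake_exists (h : H C phi) : exists z, snake (H_val h) z.
Proof.
have [x xh] := ev1t_surj phi (H_val h).
have [y yx] : exists y, sigma_1 y = phi_t x.
  apply: ev1t_ker; rewrite ev1t_phi_sub_t xh.
  by have /eqP -> := valP h; rewrite subrr.
by exists (proj_Ct C phi y), x, y.
Qed.

Lemma snake_fixed e z : snake e z -> z \in @sigma_fixed _ _ _ C d phi.
Proof.
move=> [x [y [_ xy <-]]]; apply/eqP; rewrite -proj_Ct_sigma.
apply/eqP; rewrite -subr_eq0 -proj_CtB -/(sigma_sub_id C phi y) -xy.
by rewrite proj_Ct_phi_sub_t.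
Qed.

(** If y = (phi_t - t)u, then x and (sigma - 1)u have the same image under the injective phi_t - t,
    so x = (sigma - 1)u evaluates to 0. *)
Lemma snake_eq0 e : snake e 0 -> e = 0.
Proof.
move=> [x [y [<- xy /proj_Ct_ker[u uy]]]].
rewrite -(ev1t_sigma u); congr (ev1t C phi _); apply: phi_sub_t_inj.
by rewrite xy -uy phi_sub_t_sigma.
Qed.

(** For y lifting a fixed class, (sigma - 1)y vanishes in the cokernel, so it is (phi_t - t)x; the
    value of x lies in H because sigma - 1 evaluates to 0. *)
Lemma snake_surj (z : MCt_sigma C phi) : exists h : H C phi,
  snake (H_val h) (MCt_sigma_val z).
Proof.
have /eqP zfix := valP z; have [y yz] := proj_Ct_surj (MCt_sigma_val z).
have [x xy] : exists x, phi_t x = sigma_1 y.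
  apply: proj_Ct_ker; rewrite proj_CtB proj_Ct_sigma yz.
  by rewrite [X in X - _]zfix subrr.
have eH : ev1t C phi x \in @H_pred _ _ _ C d phi.
  by apply/eqP/subr0_eq; rewrite -ev1t_phi_sub_t xy ev1t_sigma.
by exists (MkH eH), x, y.
Qed.

Definition snake_val (h : H C phi) : MCt_Fq C phi :=
  sval (cid (snake_exists h)).

Lemma snake_valP h : snake (H_val h) (snake_val h).
Proof. exact: (svalP (cid (snake_exists h))). Qed.

Definition snake_map (h : H C phi) : MCt_sigma C phi :=
  MkMCtSigma (snake_fixed (snake_valP h)).

Fact snake_map_is_linear : linear snake_map.
Proof.
move=> a h h'; apply: val_inj; apply: snake_unique (snake_valP _) _.
exact: snake_linear (snake_valP h) (snake_valP h').
Qed.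
HB.instance Definition _ := GRing.isLinear.Build {poly Fq} (H C phi)
  (MCt_sigma C phi) *:%R snake_map snake_map_is_linear.

Lemma snake_map_bij : bijective snake_map.
Proof.
have inj : injective snake_map.
  apply: raddf_inj => h h0; apply: val_inj; apply: snake_eq0.
  by have := snake_valP h; rewrite [snake_val h](congr1 val h0).
have surj z : exists h, snake_map h = z.
  have [h hz] := snake_surj z; exists h; apply: val_inj.
  exact: snake_unique (snake_valP h) hz.
exists (fun z => sval (cid (surj z))) => [h|z].
  by apply: inj; exact: svalP (cid (surj _)).
exact: svalP (cid (surj z)).
Qed.
End Snake.

Theorem theorem4p3 (R : realType) (Fq : finFieldType)
    (K : fieldExtType {fraction {poly Fq}}) (C : Cinfty R K) (d : nat)
    (phi : tmodule K d) :
  (* (1) *)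
  injective (phi_sub_t C phi) /\
  (* (2) *)
  is_cokernel (phi_sub_t C phi) (proj_Ct C phi) /\
  (* (3) the rows and the vertical maps of the diagram *)
  short_exact (sigma_sub_id C phi) (ev1t C phi) /\
  (forall x, phi_sub_t C phi (sigma_sub_id C phi x) =
             sigma_sub_id C phi (phi_sub_t C phi x)) /\
  (forall x, ev1t C phi (phi_sub_t C phi x) =
             Et_phi C phi (ev1t C phi x) - 'X *: ev1t C phi x) /\
  (* (3) the isomorphism *)
  exists Psi : {linear H C phi -> MCt_sigma C phi},
    bijective Psi /\
    forall h : H C phi,
      (exists x, ev1t C phi x = H_val h) /\
      forall x, ev1t C phi x = H_val h ->
        exists y, (forall y', phi_sub_t C phi x = sigma_sub_id C phi y' <-> y' = y)
                  /\ MCt_sigma_val (Psi h) = proj_Ct C phi y.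
Proof.
split; first exact: phi_sub_t_inj.
split.
  split=> [z|x]; first exact: proj_Ct_surj.
  by split=> [/proj_Ct_ker|[u <-]] //; exact: proj_Ct_phi_sub_t.
split.
  split; first exact: sigma_sub_id_inj.
  split=> [e|x]; first exact: ev1t_surj.
  by split=> [/ev1t_ker|[y <-]] //; exact: ev1t_sigma.
split; first exact: phi_sub_t_sigma.
split; first exact: ev1t_phi_sub_t.
exists (@snake_map R Fq K C d phi); split; first exact: snake_map_bij.
move=> h; split=> [|x xh]; first exact: ev1t_surj.
have [y yx] : exists y, sigma_sub_id C phi y = phi_sub_t C phi x.
  apply: ev1t_ker; rewrite ev1t_phi_sub_t xh.
  by have /eqP -> := valP h; rewrite subrr.
exists y; split=> [y'|].
  by rewrite -yx; split=> [/sigma_sub_id_inj|->].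
by apply: snake_unique (snake_valP h) _; exists x, y.
Qed.
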